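(* There exists an absolute constant $\epsilon > 0$ such that the following holds. Let $p$ be a prime, let $P$ be a set of $n < p$ points in $\mathbb{F}_p^2$ such that no $s$ points of $P$ are collinear, and let $\alpha,\beta \in \mathbb{F}_p \setminus \{0\}$. Then \[|\Pi_{\alpha,\beta}(P)| \leq O(s\, n^{3/2-\epsilon}),\] where the implied constant is absolute.
   Context: For a field $\mathbb{F}$, a finite set $P \subseteq \mathbb{F}^d$ and $\alpha,\beta \in \mathbb{F}$, define $\Pi_{\alpha,\beta}(P) = \{(p,q,r) \in P \times P \times P \mid p \cdot q = \alpha,\ p \cdot r = \beta\}$, where $\cdot$ is the standard dot product. ''No $s$ points of $P$ are collinear'' means every line contains fewer than $s$ points of $P$. $\mathbb{F}_p$ is the field with $p$ elements. *)

(* Defs.v *)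
From HB Require Import structures.
From mathcomp Require Import all_boot all_order all_algebra.

Set Implicit Arguments.
Unset Strict Implicit.
Unset Printing Implicit Defensive.

Import GRing.Theory.
Local Open Scope ring_scope.

Definition dotp (F : finFieldType) (d : nat) (u v : 'rV[F]_d) : F :=
  \sum_(i < d) u 0 i * v 0 i.

Definition Pi_dot (F : finFieldType) (d : nat) (alpha beta : F)
    (P : {set 'rV[F]_d}) : {set 'rV[F]_d * 'rV[F]_d * 'rV[F]_d} :=
  [set t | [&& t.1.1 \in P, t.1.2 \in P, t.2 \in P,
               dotp t.1.1 t.1.2 == alpha & dotp t.1.1 t.2 == beta]].

(* This is a genuine line only when v != 0. *)
Definition line (F : finFieldType) (d : nat) (a v : 'rV[F]_d) :
    {set 'rV[F]_d} :=
  [set a + c *: v | c : F].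

Definition no_collinear (F : finFieldType) (d : nat) (s : nat)
    (P : {set 'rV[F]_d}) : Prop :=
  forall a v : 'rV[F]_d, v != 0 -> (#|P :&: line a v| < s)%N.

(* Main.v *)
(* Once the first two points of a triple are fixed, the third runs over a line, so
   it suffices to bound the number [J] of pairs of [P] with dot product [alpha] by
   [n ^ (3/2 - eps)]: a Szemeredi-Trotter estimate of Bourgain-Katz-Tao type for
   the points [p] and the lines [p . q = alpha].

   Suppose [J >= n ^ (3/2) / K].  Two points of [P] are joined by the lines to
   a positive proportion (up to powers of [K]) of the incidences; sending them to
   infinity puts these incidences on a grid [A * B] with [#|A|, #|B|] about
   [m = n ^ (1/2)].  Two columns [x1], [x2] of the grid meet most lines, and a line
   is determined by its ordinates [y1], [y2] there; its ordinate in a column [x] is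
   proportional to [y1 + c y2] with [c = (x - x1) / (x2 - x)].  So for about [m]
   values of [c], the sum [y1 + c y2] takes few values on a dense subset of
   [B * B].  The Balog-Szemeredi-Gowers theorem and the Ruzsa-Plunnecke calculus
   then give one approximate group [G], of size about [m], such that [c G] is
   covered by few translates of [G] for all [c] in a set [M] of size about [m].
   The set of such [c] is almost closed under the field operations, and by an
   energy count it has at most about [m] elements; but a pivot argument produces
   in it either the whole field or about [m ^ 2] elements, which is a
   contradiction unless [K] is at least a power of [n]. *)
Require Import Defs.
From HB Require Import structures.
From mathcomp Require Import all_boot all_order all_algebra.
From mathcomp Require Import reals exp.
From mathcomp Require Import zify ring.

Set Implicit Arguments.
Unset Strict Implicit.
Unset Printing Implicit Defensive.

Import GRing.Theory.

(** * Counting and the Balog-Szemeredi-Gowers theorem *)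

(** Cauchy-Schwarz over the integers: with [N] terms of sum [S], add up
    [2 (N f i) S <= (N f i)^2 + S^2] and divide by [N]. *)
Lemma sum_sq_le (I : finType) (A : {set I}) (f : I -> nat) :
  (\sum_(i in A) f i) ^ 2 <= #|A| * \sum_(i in A) f i ^ 2.
Proof.
set S := \sum_(i in A) f i; set N := #|A|.
have H : \sum_(i in A) 2 * S * N * f i <= \sum_(i in A) (N ^ 2 * f i ^ 2 + S ^ 2).
  apply: leq_sum => i _; have [] := nat_Cauchy (N * f i) S; rewrite expnMn; lia.
rewrite big_split -!big_distrr /= sum_nat_const -/S -/N in H.
have [N0|N0] := posnP N; last by nia.
have -> : S = 0.
  by rewrite /S (eqP (_ : A == set0)) ?big_set0 // -cards_eq0 -/N N0.
by [].
Qed.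

(** The power mean inequality for cubes, from the tangent bound [3 v^2 u <= u^3 + 2 v^3] at
    [u = N f i] and [v = S]. *)
Lemma sum_cube_le (I : finType) (A : {set I}) (f : I -> nat) :
  (\sum_(i in A) f i) ^ 3 <= #|A| ^ 2 * \sum_(i in A) f i ^ 3.
Proof.
set S := \sum_(i in A) f i; set N := #|A|.
have tangent (u v : nat) : 3 * v ^ 2 * u <= u ^ 3 + 2 * v ^ 3.
  have [uv|vu] := leqP u v.
    have [d ->] : exists d, v = u + d by exists (v - u); rewrite subnKC.
    nia.
  have [d ->] : exists d, u = v + d by exists (u - v); rewrite subnKC // ltnW.
  nia.
have H : \sum_(i in A) 3 * S ^ 2 * N * f i <= \sum_(i in A) (N ^ 3 * f i ^ 3 + 2 * S ^ 3).
  apply: leq_sum => i _; have := tangent (N * f i) S; rewrite expnMn; lia.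
rewrite big_split -!big_distrr /= sum_nat_const -/S -/N in H.
have [N0|N0] := posnP N; last first.
  have : N * S ^ 3 <= N * (N ^ 2 * \sum_(i in A) f i ^ 3) by nia.
  by rewrite leq_pmul2l.
have -> : S = 0.
  by rewrite /S (eqP (_ : A == set0)) ?big_set0 // -cards_eq0 -/N N0.
by [].
Qed.

(** At most [N] terms lie below [S / (2 N)], and together they contribute at most [S / 2]; the
    popular terms carry the rest. *)
Lemma sum_popular (I : finType) (A : {set I}) (f : I -> nat) (N S : nat) :
  #|A| <= N -> S <= \sum_(i in A) f i ->
  S <= 2 * \sum_(i in [set i in A | S <= 2 * N * f i]) f i.
Proof.
move=> AN SA.
have [N0|N0] := posnP N.
  have A0 : A = set0 by apply/eqP; rewrite -cards_eq0 -leqn0 -N0.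
  by move: SA; rewrite A0 big_set0 leqn0 => /eqP ->.
move: SA; rewrite (bigID (fun i => S <= 2 * N * f i)) /=.
set X := \sum_(i in A | _) _; set Y := \sum_(i in A | ~~ _) _ => SXY.
have -> : \sum_(i in [set i in A | S <= 2 * N * f i]) f i = X.
  by apply: eq_bigl => i; rewrite inE.
have YS : 2 * N * Y <= N * S.
  rewrite /Y big_distrr /=.
  apply: (@leq_trans (\sum_(i in A | ~~ (S <= 2 * N * f i)) S)).
    by apply: leq_sum => i /andP[_]; rewrite -ltnNge => /ltnW.
  apply: (@leq_trans (\sum_(i in A) S)).
    by rewrite [X in _ <= X](bigID (fun i => S <= 2 * N * f i)) /= leq_addl.
  by rewrite sum_nat_const leq_mul2r AN orbT.
have : 2 * Y <= S.
  by rewrite -(leq_pmul2l N0); move: YS; rewrite mulnCA mulnA.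
lia.
Qed.

Lemma exists_le_of_sum_le (I : finType) (A : {set I}) (f g : I -> nat) :
  A != set0 -> \sum_(i in A) f i <= \sum_(i in A) g i ->
  exists2 i, i \in A & f i <= g i.
Proof.
move=> /set0Pn[i0 Ai0] H.
case: (boolP [exists i in A, f i <= g i]) => [/existsP[i /andP[? ?]]|].
  by exists i.
rewrite negb_exists => /forallP N.
suff : \sum_(i in A) g i < \sum_(i in A) f i by rewrite ltnNge H.
rewrite (bigD1 i0) //= [X in _ < X](bigD1 i0) //= -addSn.
apply: leq_add; first by move: (N i0); rewrite Ai0 /= -ltnNge.
apply: leq_sum => i /andP[Ai _].
by move: (N i); rewrite Ai /= -ltnNge => /ltnW.
Qed.

Lemma exists_ge_average (I : finType) (A : {set I}) (f : I -> nat) :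
  A != set0 -> exists2 i, i \in A & \sum_(j in A) f j <= #|A| * f i.
Proof.
move=> A0.
apply: (@exists_le_of_sum_le _ A (fun=> \sum_(j in A) f j) (fun i => #|A| * f i)) => //.
by rewrite sum_nat_const -big_distrr.
Qed.

Lemma card_le_inj (S T : finType) (A : {set S}) (B : {set T}) (f : S -> T) :
  {in A &, injective f} -> (forall x, x \in A -> f x \in B) -> #|A| <= #|B|.
Proof.
move=> finj fAB; rewrite -(card_in_imset finj); apply: subset_leq_card.
by apply/subsetP => _ /imsetP[x /fAB Bx ->].
Qed.

Lemma card_set_sum (T : finType) (A : {set T}) (P : pred T) :
  #|[set x in A | P x]| = \sum_(x in A) P x.
Proof.
rewrite -sum1_card big_mkcond [RHS]big_mkcond /=.
by apply: eq_bigr => x _; rewrite inE; case: (x \in A); case: (P x).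
Qed.

Lemma card_pairs_sum (S T : finType) (A : {set S}) (B : {set T}) (P : S -> T -> bool) :
  #|[set z in setX A B | P z.1 z.2]| = \sum_(x in A) #|[set y in B | P x y]|.
Proof.
rewrite card_set_sum; under [RHS]eq_bigr do rewrite card_set_sum.
rewrite pair_big_dep /=; apply: eq_bigl => -[x y]; by rewrite in_setX.
Qed.

Section BalogSzemerediGowers.
Variables (T : finType) (V : {set T}) (G : rel T) (m K : nat).

Let deg x := #|[set y in V | G x y]|.
Let codeg x x' := #|[set y in V | G x y && G x' y]|.

(** [A] is the set of neighbours of high degree of a well chosen vertex [y]. A pair with few common
    neighbours lies in few neighbourhoods, so on average over [y] such pairs are rare, while by
    Cauchy-Schwarz the neighbourhoods are large in mean square. *)
Lemma bsg_dense_neighbourhood (D : nat) :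
  0 < m -> #|V| <= m -> m ^ 2 <= K * \sum_(x in V) deg x ->
  exists A : {set T},
    [/\ A \subset V, forall x, x \in A -> m <= 2 * K * deg x,
        m ^ 2 <= 8 * K ^ 2 * #|A| ^ 2
      & D * \sum_(x in A) #|[set x' in A | 8 * K ^ 2 * D * codeg x x' < m]|
          <= #|A| ^ 2].
Proof.
move=> m0 Vm mG.
set E := \sum_(x in V) deg x in mG.
pose A0 := [set x in V | E <= 2 * m * deg x].
have EA0 : E <= 2 * \sum_(x in A0) deg x by exact: sum_popular.
have degA0 x : x \in A0 -> m <= 2 * K * deg x.
  rewrite inE => /andP[_ Ex].
  rewrite -(leq_pmul2l m0); apply: leq_trans (_ : K * E <= _); first by lia.
  by apply: leq_trans (leq_mul (leqnn K) Ex) _; lia.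
pose N0 y := [set x in A0 | G x y].
have sumN0 : \sum_(y in V) #|N0 y| = \sum_(x in A0) deg x.
  rewrite /N0 /deg; under eq_bigr do rewrite card_set_sum.
  by rewrite exchange_big /=; under eq_bigr do rewrite -card_set_sum.
have sqN0 : m ^ 3 <= 4 * K ^ 2 * \sum_(y in V) #|N0 y| ^ 2.
  have := sum_sq_le V (fun y => #|N0 y|); rewrite sumN0.
  set X := \sum_(x in A0) _ in EA0 *; set Y := \sum_(y in V) _ => XY.
  have XY' : X ^ 2 <= m * Y by apply: leq_trans XY _; rewrite leq_mul2r Vm orbT.
  have h1 : m ^ 2 <= 2 * K * X by apply: leq_trans mG _; rewrite -mulnA mulnCA leq_mul2l EA0 orbT.
  have h2 : (m ^ 2) ^ 2 <= (2 * K * X) ^ 2 by rewrite leq_sqr.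
  by rewrite -(leq_pmul2l m0); nia.
pose bad x x' := 8 * K ^ 2 * D * codeg x x' < m.
have A0V : A0 \subset V by apply/subsetP => x; rewrite inE => /andP[].
have sumbad : 8 * K ^ 2 * D * \sum_(y in V) #|[set z in setX (N0 y) (N0 y) | bad z.1 z.2]| <= m ^ 3.
  have -> : \sum_(y in V) #|[set z in setX (N0 y) (N0 y) | bad z.1 z.2]|
     = \sum_(z in [set z in setX A0 A0 | bad z.1 z.2]) codeg z.1 z.2.
    under [RHS]eq_bigr do rewrite /codeg card_set_sum.
    rewrite exchange_big /=; apply: eq_bigr => y _.
    rewrite -card_set_sum; apply: eq_card => -[x x'].
    rewrite !inE /=; case: (x \in V) => //=; case: (x' \in V); rewrite ?andbF //=.
    by case: (G x y); case: (G x' y); rewrite ?andbF ?andbT ?andFb.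
  rewrite big_distrr /=.
  apply: (@leq_trans (\sum_(z in [set z in setX A0 A0 | bad z.1 z.2]) m)).
    by apply: leq_sum => z; rewrite inE => /andP[_ /ltnW].
  rewrite sum_nat_const expnS mulnC leq_mul2l; apply/orP; right.
  apply: (@leq_trans #|setX V V|); last by rewrite cardsX -mulnn leq_mul.
  apply: subset_leq_card; apply/subsetP => -[x x']; rewrite inE => /andP[+ _].
  by rewrite !in_setX => /andP[/(subsetP A0V) -> /(subsetP A0V) ->].
have V0 : V != set0.
  by apply/negP => /eqP V0; move: mG; rewrite /E V0 big_set0 muln0; nia.
(* One inequality gives both conclusions: the second moment bound provides [2 m^3], of which one
   half pays for the bad pairs and the other for [m^2] at each vertex. *)
have [|y yV Hy] := @exists_le_of_sum_le _ V
  (fun y => 8 * K ^ 2 * D * #|[set z in setX (N0 y) (N0 y) | bad z.1 z.2]| + m ^ 2)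
  (fun y => 8 * K ^ 2 * #|N0 y| ^ 2) V0.
  rewrite big_split /= -!big_distrr /= sum_nat_const.
  have : #|V| * m ^ 2 <= m ^ 3 by rewrite expnS leq_mul2r Vm orbT.
  move: sumbad sqN0.
  set X1 := 8 * K ^ 2 * D * _; set X2 := \sum_(y in V) _ ^ 2; set X3 := #|V| * _.
  rewrite -[8 * K ^ 2](mulnA 2 4) -[_ * _ * X2]mulnA; move: (4 * K^2 * X2) => X4; lia.
exists (N0 y); split.
- by apply/subsetP => x; rewrite inE => /andP[/(subsetP A0V)].
- by move=> x; rewrite inE => /andP[/degA0].
- by apply: leq_trans Hy; rewrite leq_addl.
- rewrite -(card_pairs_sum (N0 y) (N0 y) bad).
  have K0 : 0 < 8 * K ^ 2.
    rewrite muln_gt0 expn_gt0 /=; case: (posnP K) mG => // ->; rewrite mul0n; nia.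
  by rewrite -(leq_pmul2l K0) mulnA; apply: leq_trans Hy; rewrite leq_addr.
Qed.

(* Pairs in the neighbourhood given by [bsg_dense_neighbourhood] mostly have
   many common neighbours; discarding the vertices which violate this too often
   leaves a side [A] such that every [a] in [A] reaches any popular [b]. *)
Lemma balog_szemeredi_gowers :
  0 < m -> #|V| <= m -> m ^ 2 <= K * \sum_(x in V) deg x ->
  exists A B : {set T},
    [/\ A \subset V, B \subset V, m <= 6 * K * #|A|, m <= 4 * K * #|B|
      & forall a b, a \in A -> b \in B ->
        m ^ 2 <= 12288 * K ^ 5 *
          #|[set z in setX V V | [&& G a z.2, G z.1 z.2 & G z.1 b]]|].
Proof.
move=> m0 Vm mG.
have K0 : 0 < K by case: (posnP K) mG => // ->; rewrite mul0n; nia.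
have [A' [A'V degA' cardA' badA']] := bsg_dense_neighbourhood (32 * K) m0 Vm mG.
set c := 8 * K ^ 2 * (32 * K) in badA'.
pose bad x := #|[set x' in A' | c * codeg x x' < m]|.
have mA' : m <= 3 * K * #|A'| by rewrite -leq_sqr; apply: leq_trans cardA' _; nia.
have A'0 : 0 < #|A'| by nia.
(* The threshold is twice the average number of bad partners, so at most half of [A'] is
   discarded. *)
pose A := [set x in A' | 32 * K * bad x <= 2 * #|A'|].
have cardA : #|A'| <= 2 * #|A|.
  have AA' : A \subset A' by apply/subsetP => x; rewrite inE => /andP[].
  have : #|A' :\: A| * (2 * #|A'|) <= #|A'| ^ 2.
    apply: leq_trans badA'; rewrite -sum_nat_const big_distrr /=.
    rewrite [X in _ <= X](big_setID A) /= -[X in X <= _]add0n.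
    apply: leq_add => //; apply: leq_sum => x; rewrite !inE => /andP[+ xA'].
    by rewrite xA' /= -ltnNge => /ltnW.
  by have := cardsID A A'; rewrite (setIidPr AA'); nia.
have AA' : A \subset A' by apply/subsetP => x; rewrite inE => /andP[].
have AV := subset_trans AA' A'V.
pose d y := #|[set x in A | G x y]|.
set E := \sum_(x in A) deg x.
have E_eq : \sum_(y in V) d y = E.
  rewrite /E /deg; under [RHS]eq_bigr do rewrite card_set_sum.
  by rewrite exchange_big /=; apply: eq_bigr => y _; rewrite -card_set_sum.
have E_ge : #|A| * m <= 2 * K * E.
  rewrite /E big_distrr /= -sum_nat_const; apply: leq_sum => x xA.
  by apply: degA'; exact: (subsetP AA').
pose B := [set y in V | E <= 2 * m * d y].
have EB : E <= 2 * \sum_(y in B) d y by apply: sum_popular => //; rewrite E_eq.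
exists A, B; split => //.
- by apply/subsetP => y; rewrite inE => /andP[].
- by nia.
- have dA y : d y <= #|A| by apply: subset_leq_card; apply/subsetP => x; rewrite inE => /andP[].
  have : \sum_(y in B) d y <= #|B| * #|A| by rewrite -sum_nat_const; apply: leq_sum.
  have A0 : 0 < #|A| by lia.
  move=> h; rewrite -(leq_pmul2l A0); nia.
- move=> a b aA; rewrite inE => /andP[bV Eb].
  have db : #|A| <= 4 * K * d b by rewrite -(leq_pmul2l m0); nia.
  have bada : 32 * K * bad a <= 2 * #|A'| by move: aA; rewrite inE => /andP[].
  (* A popular [b] has at least [#|A'| / (8 K)] neighbours in [A], and at most half that many form a
     bad pair with [a]. Each remaining [x] extends to many paths from [a] through [y] and [x] to
     [b]. *)
  pose good := [set x in A | G x b && (m <= c * codeg a x)].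
  have goodb : #|A'| <= 16 * K * #|good|.
    have : d b <= #|good| + bad a.
      have -> : d b = #|[set x in A | G x b]| by [].
      rewrite -(cardsID [set x | m <= c * codeg a x]); apply: leq_add.
        apply: subset_leq_card; apply/subsetP => x; rewrite !inE.
        by case/andP=> /andP[-> ->] ->.
      apply: subset_leq_card; apply/subsetP => x; rewrite !inE -ltnNge.
      by case/andP=> -> /andP[/andP[-> _] _].
    nia.
  set Pth := #|_|.
  have gP : \sum_(x in good) codeg a x <= Pth.
    have -> : Pth = \sum_(x in V) #|[set y in V | [&& G a y, G x y & G x b]]|.
      exact: (card_pairs_sum V V (fun x y => [&& G a y, G x y & G x b])).
    apply: (@leq_trans (\sum_(x in good) #|[set y in V | [&& G a y, G x y & G x b]]|)).
      apply: leq_sum => x; rewrite inE => /andP[_ /andP[xb _]].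
      by apply: subset_leq_card; apply/subsetP => y; rewrite !inE xb andbT.
    rewrite [X in _ <= X](big_setID good) /= (setIidPr _) ?leq_addr //.
    by apply/subsetP => x; rewrite inE => /andP[/(subsetP AV)].
  have : #|good| * m <= c * Pth.
    apply: (@leq_trans (c * \sum_(x in good) codeg a x)); last by rewrite leq_mul2l gP orbT.
    rewrite big_distrr /= -sum_nat_const; apply: leq_sum => x.
    by rewrite inE => /andP[_ /andP[_]].
  move=> gm.
  have h1 : m <= 48 * K ^ 2 * #|good|.
    apply: leq_trans mA' _.
    have -> : 48 * K ^ 2 * #|good| = 3 * K * (16 * K * #|good|) by nia.
    by rewrite leq_mul2l goodb orbT.
  apply: (@leq_trans (48 * K ^ 2 * (#|good| * m))); first by rewrite -mulnn mulnA leq_mul2r h1 orbT.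
  apply: (@leq_trans (48 * K ^ 2 * (c * Pth))); first by rewrite leq_mul2l gm orbT.
  by rewrite mulnA leq_mul2r; apply/orP; right; rewrite (_ : _ * c = 12288 * K ^ 5) // /c; ring.
Qed.

End BalogSzemerediGowers.

(** * Sumsets and dilates *)

Definition sumset (F : finFieldType) (A B : {set F}) : {set F} :=
  [set (a + b)%R | a in A, b in B].
Notation "A :+: B" := (sumset A B) (at level 50, left associativity).

Definition dilate (F : finFieldType) (c : F) (A : {set F}) : {set F} :=
  [set (c * a)%R | a in A].
Arguments dilate {F} c%_R A.

Section Sumsets.
Variable F : finFieldType.
Implicit Types (A B C G T U W X Y Z : {set F}) (a b c : F) (k : nat).
Local Open Scope ring_scope.

Lemma mem_sumset A B a b : a \in A -> b \in B -> a + b \in A :+: B.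
Proof. exact: imset2_f. Qed.

Lemma mem_dilate c A a : a \in A -> c * a \in dilate c A.
Proof. by move=> aA; apply: imset_f. Qed.

Lemma sumsetC A B : A :+: B = B :+: A.
Proof.
by apply/setP => x; apply/imset2P/imset2P => -[a b aA bB ->]; exists b a; rewrite // addrC.
Qed.

Lemma sumsetA A B C : A :+: (B :+: C) = A :+: B :+: C.
Proof.
apply/setP => x; apply/imset2P/imset2P.
  move=> [a _ aA /imset2P[b c bB cC ->] ->].
  by exists (a + b) c; rewrite ?mem_sumset // addrA.
move=> [_ c /imset2P[a b aA bB ->] cC ->].
by exists a (b + c); rewrite ?mem_sumset // addrA.
Qed.

Lemma sumsetAC A B C : A :+: B :+: C = A :+: C :+: B.
Proof. by rewrite -!sumsetA (sumsetC B). Qed.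

Lemma sumsetACA A B C T : A :+: B :+: (C :+: T) = A :+: C :+: (B :+: T).
Proof. by rewrite !sumsetA (sumsetAC A B C). Qed.

Lemma sumsetSS A B C T : A \subset C -> B \subset T -> A :+: B \subset C :+: T.
Proof.
move=> /subsetP AC /subsetP BT; apply/subsetP => _ /imset2P[a b /AC aC /BT bT ->].
exact: mem_sumset.
Qed.

Lemma sumsetUl A B C : (A :|: B) :+: C = (A :+: C) :|: (B :+: C).
Proof.
apply/setP => x; rewrite inE; apply/imset2P/orP.
  by move=> [a c]; rewrite inE => /orP[] h cC ->; [left|right]; apply: mem_sumset.
by move=> [] /imset2P[a c aA cC ->]; exists a c; rewrite // inE aA ?orbT.
Qed.

Lemma card_sumset_le A B : (#|A :+: B| <= #|A| * #|B|)%N.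
Proof.
rewrite -cardsX /sumset curry_imset2X; exact: leq_imset_card.
Qed.

Lemma sum0set A : set0 :+: A = set0.
Proof.
by apply/eqP; rewrite -cards_eq0 -leqn0; have := card_sumset_le set0 A; rewrite cards0.
Qed.

Lemma card_sumset1 c A : #|[set c] :+: A| = #|A|.
Proof.
have -> : [set c] :+: A = [set c + a | a in A].
  apply/setP => x; apply/imset2P/imsetP.
    by move=> [b a /set1P -> aA ->]; exists a.
  by move=> [a aA ->]; exists c a; rewrite ?set11.
by apply: card_imset; exact: addrI.
Qed.

Lemma card_le_sumset A B : B != set0 -> (#|A| <= #|A :+: B|)%N.
Proof.
move=> /set0Pn[b bB]; rewrite -(card_sumset1 b A) sumsetC.
by apply/subset_leq_card/sumsetSS => //; rewrite sub1set.
Qed.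

Lemma dilate_sumset c A B : dilate c (A :+: B) = dilate c A :+: dilate c B.
Proof.
apply/setP => x; apply/imsetP/imset2P.
  move=> [_ /imset2P[a b aA bB ->] ->].
  by exists (c * a) (c * b); rewrite ?mem_dilate // mulrDr.
move=> [_ _ /imsetP[a aA ->] /imsetP[b bB ->] ->].
by exists (a + b); rewrite ?mem_sumset // mulrDr.
Qed.

Lemma dilate_dilate c b A : dilate c (dilate b A) = dilate (c * b) A.
Proof.
rewrite /dilate -imset_comp; apply: eq_imset => x /=; by rewrite mulrA.
Qed.

Lemma dilate1 A : dilate 1 A = A.
Proof. by rewrite -[RHS]imset_id; apply: eq_imset => x; rewrite mul1r. Qed.

Lemma dilateS c A B : A \subset B -> dilate c A \subset dilate c B.
Proof. exact: imsetS. Qed.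

Lemma card_dilate_le c A : (#|dilate c A| <= #|A|)%N.
Proof. exact: leq_imset_card. Qed.

Lemma card_dilate c A : c != 0 -> #|dilate c A| = #|A|.
Proof. by move=> c0; apply: card_imset; apply: mulfI. Qed.

Lemma dilateD_sub a b A : dilate (a + b) A \subset dilate a A :+: dilate b A.
Proof.
by apply/subsetP => _ /imsetP[x xA ->]; rewrite mulrDl mem_sumset // mem_dilate.
Qed.

(** Here [X] minimises [#|W :+: Y| / #|W|] among its subsets. Induct on [C], adding a point [c]: if
    [W] is the part of [X] with [c + W] already in [C' :+: X], then [c + W + Y] is already counted,
    and minimality bounds what is new by the ratio. *)
Lemma petridis X Y C :
  (forall W, W \subset X -> #|X :+: Y| * #|W| <= #|W :+: Y| * #|X|)%N ->
  (#|C :+: X :+: Y| * #|X| <= #|X :+: Y| * #|C :+: X|)%N.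
Proof.
move=> minX; elim: {C}#|C| {-2}C (leqnn #|C|) => [|n IHn] C.
  rewrite leqn0 cards_eq0 => /eqP ->.
  by rewrite !sum0set cards0.
have [->|[c cC]] := set_0Vmem C; first by rewrite cards0 => _; apply: IHn; rewrite cards0.
rewrite (cardsD1 c) cC add1n ltnS => /IHn {IHn}.
rewrite -[in X in _ -> X](setD1K cC); set C' := C :\ c; rewrite !sumsetUl.
pose W := [set z in X | c + z \in C' :+: X].
have WX : W \subset X by apply/subsetP => z; rewrite inE => /andP[].
have := minX W WX.
have -> : #|[set c] :+: X :|: C' :+: X| = (#|C' :+: X| + (#|X| - #|W|))%N.
  have -> : #|W| = #|([set c] :+: X) :&: (C' :+: X)|.
    rewrite -(card_sumset1 c W); apply: eq_card => x; rewrite inE.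
    apply/imset2P/andP.
      move=> [_ z /set1P -> /[!inE] /andP[zX h] ->]; split => //.
      by rewrite mem_sumset ?set11.
    move=> [/imset2P[_ z /set1P -> zX ->] h].
    by exists c z; rewrite ?set11 // inE zX.
  rewrite cardsU card_sumset1.
  have : (#|([set c] :+: X) :&: (C' :+: X)| <= #|X|)%N.
    by rewrite -(card_sumset1 c X) subset_leq_card // subsetIl.
  by move=> h; rewrite addnC addnBA.
have h : (#|[set c] :+: X :+: Y :|: C' :+: X :+: Y| <=
          #|C' :+: X :+: Y| + (#|X :+: Y| - #|W :+: Y|))%N.
  have -> : (#|X :+: Y| - #|W :+: Y|)%N
      = #|([set c] :+: X :+: Y) :\: ([set c] :+: W :+: Y)|.
    rewrite cardsD (setIidPr _); last by rewrite !sumsetSS.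
    by rewrite -!sumsetA !card_sumset1.
  apply: leq_trans (leq_card_setU _ _).
  apply/subset_leq_card/subsetP => x; rewrite !inE => /orP[h|->//].
  case: (boolP (x \in [set c] :+: W :+: Y)) => [hx|_]; last by rewrite h orbT.
  rewrite orbF; apply: subsetP hx; apply: sumsetSS => //.
  by apply/subsetP => _ /imset2P[_ z /set1P -> /[!inE] /andP[_ hz] ->].
have u1 : (#|W :+: Y| <= #|X :+: Y|)%N by rewrite subset_leq_card // sumsetSS.
have u2 := subset_leq_card WX.
move: h u1 u2; move: #|_ :|: _| => l.
move: #|C' :+: X :+: Y| #|X :+: Y| #|W :+: Y| #|C' :+: X| #|X| #|W| => x k u a z w.
move=> h u1 u2 h1 h2.
apply: (@leq_trans ((x + (k - u)) * z)); first by rewrite leq_mul2r h orbT.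
rewrite mulnDl mulnBl mulnDr mulnBr; lia.
Qed.

(** Take for [Z] a subset of least ratio [#|Z :+: Y| / #|Z|], so that [petridis] applies to it; its
    ratio is at most that of [X], hence at most [k]. *)
Lemma plunnecke_petridis X Y k :
  X != set0 -> (#|X :+: Y| <= k * #|X|)%N ->
  exists Z, [/\ Z \subset X, Z != set0 &
    forall C, (#|C :+: Z :+: Y| <= k * #|C :+: Z|)%N].
Proof.
move=> X0 XY.
pose ratio (Z : {set F}) : rat := #|Z :+: Y|%:R / #|Z|%:R.
pose P (Z : {set F}) := (Z \subset X) && (Z != set0).
have PX : P X by rewrite /P subxx.
case: (Order.TotalTheory.arg_minP ratio PX) => Z /andP[ZX Z0] minZ.
have cross W : W \subset X -> W != set0 -> (#|Z :+: Y| * #|W| <= #|W :+: Y| * #|Z|)%N.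
  move=> WX W0; have := minZ W; rewrite /P WX W0 => /(_ isT).
  rewrite /ratio Num.Theory.ler_pdivrMr ?Num.Theory.ltr0n ?card_gt0 //.
  rewrite mulrAC Num.Theory.ler_pdivlMr ?Num.Theory.ltr0n ?card_gt0 //.
  by rewrite -!natrM Num.Theory.ler_nat.
exists Z; split=> // C.
have minZ' W : W \subset Z -> (#|Z :+: Y| * #|W| <= #|W :+: Y| * #|Z|)%N.
  move=> WZ; have [->|W0] := eqVneq W set0; first by rewrite cards0 muln0.
  by apply: cross => //; apply: subset_trans ZX.
have := petridis C minZ'.
have := cross X (subxx _) X0.
have : (0 < #|X|)%N by rewrite card_gt0.
have : (0 < #|Z|)%N by rewrite card_gt0.
move: XY.
move: #|C :+: Z :+: Y| #|Z :+: Y| #|X :+: Y| #|C :+: Z| #|X| #|Z| => a b c d x z.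
move=> h1 z0 x0 h2 h3.
have h4 : (b <= k * z)%N.
  rewrite -(leq_pmul2r x0); apply: leq_trans h2 _.
  by rewrite mulnAC leq_mul2r h1 orbT.
rewrite -(leq_pmul2r z0); apply: leq_trans h3 _.
by rewrite mulnAC leq_mul2r h4 orbT.
Qed.

(** Fix one representation [x = b - c] of each difference; then [(a, x) |-> (a + b, a + c)] is
    injective, since subtracting the coordinates returns [x]. *)
Lemma ruzsa_triangle A B C :
  (#|A| * #|B :+: dilate (-1) C| <= #|A :+: B| * #|A :+: C|)%N.
Proof.
have ex x : x \in B :+: dilate (-1) C -> exists z : F * F,
    [&& z.1 \in B, z.2 \in C & x == z.1 - z.2].
  move=> /imset2P[b _ bB /imsetP[c cC ->] ->]; exists (b, c) => /=.
  by rewrite bB cC mulN1r eqxx.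
pose rep x := odflt ((0 : F), (0 : F)) [pick z : F * F | [&& z.1 \in B, z.2 \in C & x == z.1 - z.2]].
have repP x : x \in B :+: dilate (-1) C ->
    [&& (rep x).1 \in B, (rep x).2 \in C & x == (rep x).1 - (rep x).2].
  by move=> /ex[z hz]; rewrite /rep; case: pickP => [|/(_ z)]; rewrite ?hz.
rewrite -!cardsX.
apply: (@card_le_inj _ _ _ _ (fun z => (z.1 + (rep z.2).1, z.1 + (rep z.2).2))).
  move=> [a x] [a' x'] /setXP[/= _ xD] /setXP[/= _ xD'] [e1 e2].
  have /and3P[_ _ /eqP ex1] := repP _ xD; have /and3P[_ _ /eqP ex2] := repP _ xD'.
  have xx : x = x'.
    rewrite ex1 ex2 (_ : _ - _ = a + (rep x).1 - (a + (rep x).2)); last by ring.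
    by rewrite e1 e2; ring.
  by subst x'; move/addIr: e1 => ->.
move=> [a x] /setXP[/= aA /repP /and3P[? ? _]].
by apply/setXP; split; apply: mem_sumset.
Qed.

(** Unlike bounds on cardinalities, coverings by translates compose: they pass to sums, to dilates
    and along chains of sets. *)
Definition covered k A G := exists2 T : {set F}, (#|T| <= k)%N & A \subset T :+: G.

(** Take [T] in [A] maximal with the translates [t + B] disjoint, which [#|T :+: B| = #|T| * #|B|]
    encodes. For each [a] in [A], [a + B] then meets some [t + B], so that [a] lies in
    [t + B - B]. *)
Lemma ruzsa_covering A B k :
  B != set0 -> (#|A :+: B| <= k * #|B|)%N -> covered k A (B :+: dilate (-1) B).
Proof.
move=> B0 AB.
pose P (T : {set F}) := (T \subset A) && (#|T :+: B| == #|T| * #|B|)%N.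
have P0 : P set0.
  by rewrite /P sub0set sum0set cards0 mul0n.
have [T /maxsetP[/andP[TA /eqP TB] maxT] _] := maxset_exists P0.
exists T.
  have Bpos : (0 < #|B|)%N by rewrite card_gt0.
  rewrite -(leq_pmul2r Bpos) -TB; apply: leq_trans AB.
  by apply/subset_leq_card/sumsetSS.
apply/subsetP => a aA.
have [/pred0P dis|/existsP[x]] := boolP [disjoint [set a] :+: B & T :+: B].
  suff aT : a \in T.
    have /set0Pn[b bB] := B0.
    have -> : a = a + (b + -1 * b) by ring.
    by rewrite !mem_sumset // mem_dilate.
  have aTB : [disjoint [set a] :+: B & T :+: B] by apply/pred0P.
  apply: contraT => aT.
  have aTT : a |: T = T.
    apply: maxT; last exact: subsetUr.
    rewrite /P subUset sub1set aA TA /= sumsetUl cardsU1 aT mulnDl mul1n -TB.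
    by rewrite cardsU (disjoint_setI0 aTB) cards0 subn0 card_sumset1.
  by rewrite -aTT setU11 in aT.
rewrite inE /= => /andP[/imset2P[_ b /set1P -> bB ->] /imset2P[t b' tT b'B e]].
have -> : a = t + (b' + -1 * b) by rewrite addrA -e; ring.
by rewrite !mem_sumset // mem_dilate.
Qed.

Lemma coveredW k k' A A' G :
  (k <= k')%N -> A' \subset A -> covered k A G -> covered k' A' G.
Proof.
by move=> kk AA [T Tk AT]; exists T; [apply: leq_trans kk|apply: subset_trans AT].
Qed.

Lemma covered_trans k l A B G :
  covered k A B -> covered l B G -> covered (k * l) A G.
Proof.
move=> [T Tk AT] [U Ul BU]; exists (T :+: U).
  exact: leq_trans (card_sumset_le _ _) (leq_mul _ _).
by rewrite -sumsetA; apply: subset_trans AT _; apply: sumsetSS.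
Qed.

Lemma covered_sumset k l A B G H :
  covered k A G -> covered l B H -> covered (k * l) (A :+: B) (G :+: H).
Proof.
move=> [T Tk AT] [U Ul BU]; exists (T :+: U).
  exact: leq_trans (card_sumset_le _ _) (leq_mul _ _).
by rewrite sumsetACA; apply: sumsetSS.
Qed.

Lemma covered_dilate c k A G : covered k A G -> covered k (dilate c A) (dilate c G).
Proof.
move=> [T Tk AT]; exists (dilate c T).
  exact: leq_trans (card_dilate_le _ _) _.
by rewrite -dilate_sumset dilateS.
Qed.

Lemma card_covered k A G : covered k A G -> (#|A| <= k * #|G|)%N.
Proof.
move=> [T Tk /subset_leq_card h]; apply: leq_trans h _.
by apply: leq_trans (card_sumset_le _ _) _; rewrite leq_mul2r Tk orbT.
Qed.

Lemma dilateN_diff A :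
  dilate (-1) (A :+: dilate (-1) A) = A :+: dilate (-1) A.
Proof. by rewrite dilate_sumset dilate_dilate mulrNN mulr1 dilate1 sumsetC. Qed.

(** * Dilations that almost preserve an approximate group *)

Section NearInvariance.
Variables (G : {set F}) (K g : nat).
Hypothesis K_gt0 : (0 < K)%N.
Hypothesis G_neq0 : G != set0.
Hypothesis G_sym : dilate (-1) G = G.
Hypothesis G_double : covered (K ^ g) (G :+: G) G.

(** Losses are recorded as exponents of the fixed [K], so that the closure properties under field
    operations only add exponents. *)
Definition near_invariant (e : nat) (c : F) := covered (K ^ e) (dilate c G) G.

Lemma near_invariantW e f c : (e <= f)%N -> near_invariant e c -> near_invariant f c.
Proof. by move=> ef; apply: coveredW => //; rewrite leq_pexp2l. Qed.

Lemma near_invariant1 : near_invariant 0 1.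
Proof.
exists [set 0]; first by rewrite cards1.
rewrite dilate1; apply/subsetP => x xG; rewrite -[x]add0r.
by rewrite mem_sumset // set11.
Qed.

Lemma near_invariantD e f a b :
  near_invariant e a -> near_invariant f b -> near_invariant (e + f + g) (a + b).
Proof.
move=> ha hb; rewrite /near_invariant !expnD.
apply: coveredW (leqnn _) (dilateD_sub a b G) _.
by apply: covered_trans G_double; apply: covered_sumset.
Qed.

Lemma near_invariantN e a : near_invariant e a -> near_invariant e (- a).
Proof. by rewrite /near_invariant -mulrN1 -dilate_dilate G_sym. Qed.

Lemma near_invariantM e f a b :
  near_invariant e a -> near_invariant f b -> near_invariant (e + f) (a * b).
Proof.
move=> ha hb; rewrite /near_invariant -dilate_dilate addnC expnD.
by apply: covered_trans ha; apply: covered_dilate.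
Qed.

Lemma card_near_invariant e a :
  near_invariant e a -> (#|G :+: dilate a G| <= K ^ (e + g) * #|G|)%N.
Proof.
move=> [T Tk aT]; rewrite expnD -mulnA.
apply: leq_trans (leq_mul Tk (card_covered G_double)).
apply: leq_trans (card_sumset_le _ _).
apply/subset_leq_card; rewrite sumsetA (sumsetC T) -sumsetA.
exact: sumsetSS.
Qed.

(** Dilation by [a] gives [G + a^-1 G] the size of [G + a G]. The covering lemma then covers
    [a^-1 G] by translates of [G - G = G + G]. *)
Lemma near_invariantV e a :
  a != 0 -> near_invariant e a -> near_invariant (e + g + g) a^-1.
Proof.
move=> a0 ha; rewrite /near_invariant expnD.
apply: covered_trans G_double; rewrite -{3}G_sym.
apply: ruzsa_covering => //.
rewrite -(card_dilate _ a0) dilate_sumset dilate_dilate divff // dilate1.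
exact: card_near_invariant.
Qed.

End NearInvariance.

(* Each [c] in [S] makes the additive energy of [G] and [c G] large, whereas
   a nontrivial coincidence [a + c b = a' + c b'] determines [c]. *)
Lemma card_small_dilates_le (G S : {set F}) k :
  G != set0 -> (2 * k <= #|G|)%N ->
  (forall c, c \in S -> #|G :+: dilate c G| <= k * #|G|)%N ->
  (#|S| <= 2 * k * #|G|)%N.
Proof.
rewrite -card_gt0 => Gpos kG small.
pose V := setX G G.
pose E (c : F) := #|[set z in setX V V | z.1.1 + c * z.1.2 == z.2.1 + c * z.2.2]|.
have lowE c : c \in S -> (#|G| ^ 3 <= k * E c)%N.
  move=> cS.
  pose r (s : F) := #|[set z in V | z.1 + c * z.2 == s]|.
  have sr : (\sum_(s in G :+: dilate c G) r s = #|G| ^ 2)%N.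
    rewrite -mulnn -cardsX -sum1_card.
    rewrite (partition_big (fun z => z.1 + c * z.2) (mem (G :+: dilate c G))) /=.
      by apply: eq_bigr => s _; rewrite /r -sum1_card; apply: eq_bigl => z; rewrite !inE.
    by move=> [a b] /setXP[aG bG] /=; rewrite mem_sumset // mem_dilate.
  have sr2 : (\sum_(s in G :+: dilate c G) r s ^ 2 <= E c)%N.
    rewrite /E -sum1_card.
    rewrite (partition_big (fun z => z.1.1 + c * z.1.2) (mem (G :+: dilate c G))) /=.
      apply: leq_sum => s _; rewrite /r -mulnn -cardsX -sum1_card.
      apply: eq_leq; apply: eq_bigl => -[[a b] [a' b']]; rewrite !inE /=.
      case: (a \in G); case: (b \in G); case: (a' \in G); case: (b' \in G); rewrite ?andbF //=.
      by apply/andP/andP => [[/eqP-> /eqP->]|[/eqP<- /eqP->]].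
    move=> [[a b] [a' b']]; rewrite inE => /andP[/setXP[/setXP[aG bG] _] _] /=.
    by rewrite mem_sumset // mem_dilate.
  have := sum_sq_le (G :+: dilate c G) r; rewrite sr => h.
  have {}h : ((#|G| ^ 2) ^ 2 <= k * #|G| * E c)%N.
    by apply: leq_trans h _; rewrite leq_mul // small.
  rewrite -(leq_pmul2l Gpos); apply: leq_trans (_ : (#|G| ^ 2) ^ 2 <= _)%N; last by lia.
  by rewrite -expnM -expnS.
have upE : (\sum_(c in S) E c <= #|S| * #|G| ^ 2 + #|G| ^ 4)%N.
  have -> : (\sum_(c in S) E c)%N
    = #|[set x in setX S (setX V V) |
         x.2.1.1 + x.1 * x.2.1.2 == x.2.2.1 + x.1 * x.2.2.2]|.
    by rewrite (card_pairs_sum S (setX V V)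
      (fun c z => z.1.1 + c * z.1.2 == z.2.1 + c * z.2.2)).
  (* Trivial coincidences, with equal pairs, number at most [#|S| * #|G|^2]; in the others the two
     pairs determine [c], leaving at most [#|G|^4]. *)
  rewrite -(cardsID [set x : F * (F * F * (F * F)) | x.2.1 == x.2.2]).
  apply: leq_add.
    rewrite -mulnn -[(#|G| * _)%N]cardsX -cardsX.
    apply: (@card_le_inj _ _ _ _ (fun x => (x.1, x.2.1))).
      move=> [c [z z']] [d [w w']]; rewrite !inE /= => /andP[_ /eqP ->] /andP[_ /eqP ->].
      by case=> -> ->.
    by move=> [c [z z']]; rewrite !inE /= => /andP[/andP[/and3P[-> /andP[-> ->]]]].
  rewrite (_ : 4 = 2 + 2)%N // expnD -mulnn -[(#|G| * _)%N]cardsX -cardsX.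
  apply: (@card_le_inj _ _ _ _ (fun x => x.2)).
    move=> [c [[a b] [a' b']]] [d [w w']]; rewrite !inE /= => /andP[ne /andP[_ /eqP e1]].
    move=> /andP[_ /andP[_ /eqP e2]] e; move: e2; case: e => <- <- /= e2.
    congr (_, _); apply/eqP; rewrite -subr_eq0; apply/negP => /negP cd.
    have : (c - d) * (b - b') = 0.
      have -> : (c - d) * (b - b') = (a + c * b - (a' + c * b')) - (a + d * b - (a' + d * b')) by ring.
      by rewrite e1 e2; ring.
    move=> /eqP; rewrite mulf_eq0 (negbTE cd) subr_eq0 => /eqP bb.
    by move: e1 ne; rewrite bb => /addIr ->; rewrite eqxx.
  by move=> [c [[a b] [a' b']]]; rewrite !inE /= => /andP[_ /andP[/andP[_ ->]]].
have low : (#|S| * #|G| ^ 3 <= k * \sum_(c in S) E c)%N.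
  by rewrite big_distrr /= -sum_nat_const; apply: leq_sum.
have {low upE} : (#|S| * #|G| ^ 3 <= k * (#|S| * #|G| ^ 2 + #|G| ^ 4))%N.
  by apply: leq_trans low _; rewrite leq_mul2l upE orbT.
move: #|S| #|G| kG Gpos => s x kG x0 h.
have x2 : (0 < x ^ 2)%N by rewrite expn_gt0 x0.
have {}h : (s * x <= k * (s + x ^ 2))%N.
  by rewrite -(leq_pmul2r x2); apply: leq_trans (_ : s * x ^ 3 <= _)%N; [lia|apply: leq_trans h _; lia].
(* As [2 k <= x], the term [k s] is at most half of [s x] and is absorbed on the left. *)
have h2 : (s * (2 * k) <= s * x)%N by rewrite leq_mul2l kG orbT.
rewrite -(leq_pmul2r x0); nia.
Qed.

End Sumsets.

(** * Dilates with few sums *)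

(** Join [x] to [y] when [x + c y] is in [S]. A path from [a] through [v] and [u] to [b] writes
    [a + c b] as [(a + c v) - (u + c v) + (u + c b)], with all three terms in [S]. Each element of
    [A + c B] has many such expressions, and there are at most [m^3] triples from [S]. *)
Lemma bsg_sumset (F : finFieldType) (V S : {set F}) (c : F) (m K : nat) :
  c != 0%R -> 0 < m -> #|V| <= m -> #|S| <= m ->
  m ^ 2 <= K * #|[set z in setX V V | (z.1 + c * z.2)%R \in S]| ->
  exists A B : {set F},
    [/\ A \subset V, B \subset V, m <= 12288 * K ^ 5 * #|A|, m <= 12288 * K ^ 5 * #|B|
      & #|A :+: dilate c B| <= 12288 * K ^ 5 * m].
Proof.
move=> c0 m0 Vm Sm mG.
pose G x y := (x + c * y)%R \in S.
rewrite (card_pairs_sum V V G) in mG.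
have K0 : 0 < K by case: (posnP K) mG => // ->; rewrite mul0n; nia.
have [A [B [AV BV mA mB path]]] := balog_szemeredi_gowers m0 Vm mG.
have KK : 6 * K <= 12288 * K ^ 5.
  by rewrite leq_mul // -[X in X <= _]expn1 leq_pexp2l.
exists A, B; split => //.
- by apply: leq_trans mA _; rewrite leq_mul2r KK orbT.
- apply: leq_trans mB _; rewrite leq_mul2r (leq_trans _ KK) ?orbT //.
  by rewrite leq_mul2r orbT.
pose D := A :+: dilate c B.
pose P x (z : F * F) := [&& z.1 \in A, z.2 \in B & x == z.1 + c * z.2]%R.
pose rep x := odflt (0%R, 0%R) [pick z : F * F | P x z].
have repP x : x \in D -> P x (rep x).
  move=> /imset2P[a _ aA /imsetP[b bB ->] xE].
  rewrite /rep; case: pickP => // /(_ (a, b)); rewrite /P aA bB /= xE.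
  by rewrite eqxx.
pose Paths x := [set z in setX V V | [&& G (rep x).1 z.2, G z.1 z.2 & G z.1 (rep x).2]].
have h1 : #|D| * m ^ 2 <= 12288 * K ^ 5 * \sum_(x in D) #|Paths x|.
  rewrite big_distrr /= -sum_nat_const; apply: leq_sum => x /repP /and3P[aA bB _].
  exact: path.
have h2 : \sum_(x in D) #|Paths x| <= m ^ 3.
  have -> : \sum_(x in D) #|Paths x| = #|[set w in setX D (setX V V) |
     [&& G (rep w.1).1 w.2.2, G w.2.1 w.2.2 & G w.2.1 (rep w.1).2]]|.
    by rewrite (card_pairs_sum D (setX V V) (fun x z =>
      [&& G (rep x).1 z.2, G z.1 z.2 & G z.1 (rep x).2])).
  apply: (@leq_trans #|setX S (setX S S)|); last first.
    by rewrite !cardsX !expnS expn0 muln1 !leq_mul.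
  apply: (@card_le_inj _ _ _ _ (fun w => ((rep w.1).1 + c * w.2.2,
     (w.2.1 + c * w.2.2, w.2.1 + c * (rep w.1).2)))%R).
    move=> [x [u v]] [x' [u' v']]; rewrite !inE /=.
    move=> /andP[/andP[/repP /and3P[_ _ /eqP xE] _] _].
    move=> /andP[/andP[/repP /and3P[_ _ /eqP xE'] _] _] [e1 e2 e3].
    have xx : x = x'.
      have -> : x = ((rep x).1 + c * v - (u + c * v) + (u + c * (rep x).2))%R.
        by rewrite {1}xE; ring.
      by rewrite e1 e2 e3 {3}xE'; ring.
    subst x'; move/addrI/(mulfI c0): e1 => ?; subst v'.
    by move/addIr: e2 => ->.
  move=> [x [u v]]; rewrite !inE /= => /andP[_ /and3P[? ? ?]].
  by apply/andP; split => //; apply/andP.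
rewrite -/D -(leq_pmul2r (_ : 0 < m ^ 2)) ?expn_gt0 ?m0 //.
apply: leq_trans h1 _; apply: leq_trans (leq_mul (leqnn _) h2) _.
by rewrite (expnS m 2) mulnA.
Qed.

Lemma setX_setI (S T : finType) (A A' : {set S}) (B B' : {set T}) :
  setX A B :&: setX A' B' = setX (A :&: A') (B :&: B').
Proof. by apply/setP => -[x y]; rewrite !inE andbACA. Qed.

(** By Cauchy-Schwarz on the multiplicities of points of [V], sets of density [1 / c] meet pairwise
    in density [1 / c^2] on average. Take [i0] with the largest total intersection and keep the
    indices popular for it. *)
Lemma popular_intersection (I T : finType) (L : {set I}) (V : {set T})
    (U : I -> {set T}) (M c : nat) :
  0 < M -> L != set0 -> #|V| <= M ->
  (forall i, i \in L -> U i \subset V) ->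
  (forall i, i \in L -> M <= c * #|U i|) ->
  exists2 i0, i0 \in L & exists L' : {set I}, [/\ L' \subset L, #|L| <= 2 * c ^ 2 * #|L'|
    & forall i, i \in L' -> M <= 2 * c ^ 2 * #|U i :&: U i0|].
Proof.
move=> M0 L0 VM UV Uc.
have Lpos : 0 < #|L| by rewrite card_gt0.
pose r b := #|[set i in L | b \in U i]|.
have sr : \sum_(b in V) r b = \sum_(i in L) #|U i|.
  rewrite /r; under eq_bigr do rewrite card_set_sum.
  rewrite exchange_big /=; apply: eq_bigr => i iL; rewrite -card_set_sum.
  apply: eq_card => b; rewrite inE; case: (boolP (b \in U i)) => [|_]; rewrite ?andbF //.
  by rewrite andbT => /(subsetP (UV _ iL)).
have sr2 : \sum_(b in V) r b ^ 2 = \sum_(j in L) \sum_(i in L) #|U i :&: U j|.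
  have sq b : r b ^ 2 = \sum_(j in L) \sum_(i in L) ((b \in U i) && (b \in U j)).
    rewrite -mulnn {2}/r card_set_sum big_distrr /=; apply: eq_bigr => j jL.
    rewrite /r card_set_sum big_distrl /=; apply: eq_bigr => i _.
    by case: (b \in U i); case: (b \in U j).
  under eq_bigr do rewrite sq.
  rewrite exchange_big /=; apply: eq_bigr => j jL; rewrite exchange_big /=.
  apply: eq_bigr => i iL; rewrite -card_set_sum; apply: eq_card => b; rewrite !inE.
  by case: (boolP (b \in U i)) => [/(subsetP (UV _ iL)) ->|]; rewrite ?andbF.
have [j jL jmax] := exists_ge_average (fun j => \sum_(i in L) #|U i :&: U j|) L0.
exists j => //; set S := \sum_(i in L) #|U i :&: U j| in jmax.
have low : #|L| * M <= c * \sum_(i in L) #|U i|.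
  by rewrite big_distrr /= -sum_nat_const; apply: leq_sum.
have S_ge : #|L| * M <= c ^ 2 * S.
  have := sum_sq_le V r; rewrite sr sr2.
  move: low jmax; move: (\sum_(i in L) #|U i|) (\sum_(j in L) \sum_(i in L) _) => x y low jmax h.
  have h1 : (#|L| * M) ^ 2 <= (c * x) ^ 2 by rewrite leq_sqr.
  have h2 : x ^ 2 <= M * (#|L| * S) by apply: leq_trans h _; rewrite leq_mul.
  rewrite -(leq_pmul2l (_ : 0 < #|L| * M)) ?muln_gt0 ?Lpos //.
  rewrite mulnn; apply: leq_trans h1 _; rewrite expnMn.
  apply: leq_trans (_ : c ^ 2 * (M * (#|L| * S)) <= _); first by rewrite leq_mul2l h2 orbT.
  lia.
exists [set i in L | S <= 2 * #|L| * #|U i :&: U j|]; split.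
- by apply/subsetP => i; rewrite inE => /andP[].
- have h := @sum_popular _ L (fun i => #|U i :&: U j|) _ S (leqnn _) (leqnn _).
  have h2 : \sum_(i in [set i in L | S <= 2 * #|L| * #|U i :&: U j|]) #|U i :&: U j|
       <= #|[set i in L | S <= 2 * #|L| * #|U i :&: U j|]| * M.
    rewrite -sum_nat_const; apply: leq_sum => i; rewrite inE => /andP[iL _].
    apply: leq_trans VM; apply: subset_leq_card.
    exact: subset_trans (subsetIl _ _) (UV _ iL).
  rewrite -(leq_pmul2r M0); nia.
- move=> i; rewrite inE => /andP[iL Si].
  rewrite -(leq_pmul2l Lpos); nia.
Qed.

(** * An approximate group shared by many dilates *)

Section CommonApproximateGroup.
Variables (F : finFieldType) (X Y : {set F}) (m K : nat).
Hypotheses (m0 : 0 < m) (Xm : #|X| <= m).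
Hypotheses (mX : m <= K * #|X|) (mY : m <= K * #|Y|) (XY : #|X :+: Y| <= K * m).

Let X0 : X != set0.
Proof. by rewrite -card_gt0; case: posnP mX => // ->; rewrite muln0 leqNgt m0. Qed.

Let Y0 : Y != set0.
Proof. by rewrite -card_gt0; case: posnP mY => // ->; rewrite muln0 leqNgt m0. Qed.

(** Relative to the set [Z] of [plunnecke_petridis], each added copy of [Y] costs [K^2]. The
    triangle inequality through [Z] then combines three copies and two copies at cost
    [K^(6 + 4)]. *)
Lemma iterated_sumset_bounds :
  #|Y :+: Y| <= K ^ 4 * m /\
  #|Y :+: Y :+: Y :+: dilate (-1) (Y :+: Y)| <= K ^ 10 * m.
Proof.
have XY2 : #|X :+: Y| <= K ^ 2 * #|X|.
  by apply: leq_trans XY _; rewrite expnS expn1 -mulnA leq_mul2l mX orbT.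
have [Z [ZX Z0 hZ]] := plunnecke_petridis X0 XY2.
have Zm : #|Z| <= m by apply: leq_trans Xm; apply: subset_leq_card.
have b1 : #|Z :+: Y| <= K ^ 2 * #|Z|.
  have := hZ [set 0%R]; by rewrite -sumsetA !card_sumset1.
have b2 : #|Z :+: (Y :+: Y)| <= K ^ 4 * #|Z|.
  rewrite sumsetA (sumsetC Z); apply: leq_trans (hZ _) _.
  by rewrite sumsetC (expnD K 2 2) -mulnA leq_mul2l b1 orbT.
have b3 : #|Z :+: (Y :+: Y :+: Y)| <= K ^ 6 * #|Z|.
  rewrite sumsetA (sumsetC Z); apply: leq_trans (hZ _) _.
  by rewrite sumsetC (expnD K 2 4) -mulnA leq_mul2l b2 orbT.
split.
  apply: leq_trans (card_le_sumset _ Z0) _; rewrite sumsetC; apply: leq_trans b2 _.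
  by rewrite leq_mul2l Zm orbT.
have Zpos : 0 < #|Z| by rewrite card_gt0.
rewrite -(leq_pmul2l Zpos).
apply: leq_trans (ruzsa_triangle Z (Y :+: Y :+: Y) (Y :+: Y)) _.
apply: leq_trans (leq_mul b3 b2) _.
rewrite mulnACA -expnD mulnC -mulnA leq_mul2l; apply/orP; right.
by rewrite mulnC leq_mul2l Zm orbT.
Qed.

Let G := Y :+: dilate (-1) Y.

(** [G + G + Y] equals [3 Y - 2 Y], which is small, so the covering lemma applies with
    [G = Y - Y]. *)
Lemma difference_double : covered (K ^ 11) (G :+: G) G.
Proof.
apply: ruzsa_covering => //.
have -> : G :+: G :+: Y = Y :+: Y :+: Y :+: dilate (-1) (Y :+: Y).
  by rewrite /G sumsetACA -dilate_sumset sumsetAC.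
have [_ h] := iterated_sumset_bounds; apply: leq_trans h _.
by rewrite (expnD K 10 1) -mulnA leq_mul2l expn1 mY orbT.
Qed.

Lemma card_difference_le : #|G| <= K ^ 10 * m.
Proof.
have [_ h] := iterated_sumset_bounds; apply: leq_trans h.
have -> : Y :+: Y :+: Y :+: dilate (-1) (Y :+: Y) = G :+: (G :+: Y).
  by rewrite /G sumsetA sumsetACA -dilate_sumset sumsetAC.
apply: card_le_sumset.
have /set0Pn[y yY] := Y0; apply/set0Pn; exists (y + -1 * y + y)%R.
by rewrite !mem_sumset // mem_dilate.
Qed.

Lemma card_difference_ge : m <= K * #|G|.
Proof.
apply: leq_trans mY _; rewrite leq_mul2l; apply/orP; right; apply: card_le_sumset.
have /set0Pn[y yY] := Y0; apply/set0Pn; exists (-1 * y)%R; exact: mem_dilate.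
Qed.

(** A chain of coverings: [c Y'] by [X' - X'], inside [X - X], itself covered by [G]; and [Y] by
    [Y' - Y'], hence [c Y] by [c Y' - c Y']. The exponents are [21 = 6 + 15], [62 = 9 + 42 + 11] and
    [135 = 124 + 11]. *)
Lemma near_invariant_of_partial (X' Y' : {set F}) (c : F) :
  X' \subset X -> Y' \subset Y -> m <= K ^ 5 * #|X'| -> m <= K ^ 5 * #|Y'| ->
  #|X' :+: dilate c Y'| <= K * m -> near_invariant G K 135 c.
Proof.
move=> X'X Y'Y mX' mY' h.
have neg (k : nat) (A B : {set F}) : covered k A B ->
    covered (k * k) (A :+: dilate (-1) A) (B :+: dilate (-1) B).
  by move=> hA; apply: covered_sumset hA (covered_dilate _ hA).
have GK : covered (K ^ 11) (G :+: dilate (-1) G) G.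
  by rewrite dilateN_diff; apply: difference_double.
have X'0 : X' != set0.
  by rewrite -card_gt0; case: posnP mX' => // ->; rewrite muln0 leqNgt m0.
have Y'0 : Y' != set0.
  by rewrite -card_gt0; case: posnP mY' => // ->; rewrite muln0 leqNgt m0.
have cXG : covered (K ^ 2) X G.
  apply: ruzsa_covering => //; apply: leq_trans XY _.
  by rewrite expnS expn1 -mulnA leq_mul2l mY orbT.
have cX : covered (K ^ 15) (X :+: dilate (-1) X) G.
  rewrite (expnD K 4 11); apply: covered_trans GK.
  by rewrite (expnD K 2 2); apply: neg.
have cY' : covered (K ^ 21) (dilate c Y') G.
  rewrite (expnD K 6 15); apply: covered_trans cX.
  have c1 : covered (K ^ 6) (dilate c Y') (X' :+: dilate (-1) X').
    apply: ruzsa_covering => //; rewrite sumsetC; apply: leq_trans h _.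
    by rewrite expnS -mulnA leq_mul2l mX' orbT.
  have [T Tk sub] := c1; exists T => //; apply: subset_trans sub _.
  by rewrite !sumsetSS // dilateS.
have cYY : covered (K ^ 9) Y (Y' :+: dilate (-1) Y').
  apply: ruzsa_covering => //.
  apply: (@leq_trans #|Y :+: Y|); first by rewrite subset_leq_card // sumsetSS.
  have [h1 _] := iterated_sumset_bounds; apply: leq_trans h1 _.
  by rewrite (expnD K 4 5) -mulnA leq_mul2l mY' orbT.
have cY : covered (K ^ 62) (dilate c Y) G.
  rewrite (expnD K 9 53); apply: covered_trans (covered_dilate c cYY) _.
  rewrite dilate_sumset dilate_dilate mulrC -dilate_dilate.
  rewrite (expnD K 42 11); apply: covered_trans GK.
  by rewrite (expnD K 21 21); apply: neg.
rewrite /near_invariant /G dilate_sumset dilate_dilate mulrC -dilate_dilate.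
rewrite (expnD K 124 11); apply: covered_trans GK.
by rewrite (expnD K 62 62); apply: neg.
Qed.

End CommonApproximateGroup.

(* If the quotient set [R] of [M] is not the whole field, it is not closed
   under [x |-> x + 1]; for [r \in R] with [r + 1 \notin R] the map
   [(a, b) |-> a + (r + 1) b] is injective on [M * M]. *)
Lemma pivot (p : nat) (G M : {set 'F_p}) (K g e : nat) :
  prime p -> 0 < K -> G != set0 -> dilate (-1) G = G -> covered (K ^ g) (G :+: G) G ->
  1 < #|M| -> (forall c, c \in M -> near_invariant G K e c) ->
  exists2 S : {set 'F_p}, forall c, c \in S -> near_invariant G K (6 * e + 6 * g) c
    & p <= #|S| \/ #|M| ^ 2 <= #|S|.
Proof.
move=> pr_p K0 G0 Gsym Gd M2 hM.
pose q (z : 'F_p * 'F_p * ('F_p * 'F_p)) := ((z.1.1 - z.1.2) / (z.2.1 - z.2.2))%R.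
pose R := [set q z | z in [set z in setX (setX M M) (setX M M) | z.2.1 != z.2.2]].
have hR r : r \in R -> near_invariant G K (4 * e + 4 * g) r.
  case/imsetP => -[[a b] [c d]]; rewrite inE /q /=.
  move=> /andP[/setXP[/setXP[/= aM bM] /setXP[/= cM dM]] cd] ->.
  have -> : 4 * e + 4 * g = (e + e + g) + ((e + e + g) + g + g) by lia.
  apply: near_invariantM.
    by apply: near_invariantD => //; [exact: hM | apply: near_invariantN => //; exact: hM].
  apply: near_invariantV => //; first by rewrite subr_eq0.
  by apply: near_invariantD => //; [exact: hM | apply: near_invariantN => //; exact: hM].
have [/forallP RT|] := boolP [forall x, x \in R].
  exists setT; last by left; rewrite cardsT card_Fp.
  move=> c _; apply: near_invariantW (hR c (RT c)) => //; lia.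
rewrite negb_forall => /existsP[x0 x0R].
have [r rR r1R] : exists2 r, r \in R & (r + 1)%R \notin R.
  have [/existsP[r /andP[rR rR1]]|] := boolP [exists r, (r \in R) && ((r + 1)%R \notin R)].
    by exists r.
  rewrite negb_exists => /forallP closed.
  (* Since [0] is in [R], closure under adding [1] would put every residue in [R], including
     [x0]. *)
  suff nR n : (n%:R : 'F_p)%R \in R by rewrite -(natr_Zp x0) nR in x0R.
  elim: n => [|n IHn]; last first.
    by have := closed n%:R%R; rewrite IHn /= negbK natr1.
  have /card_gt1P[c [d [cM dM cd]]] := M2.
  apply/imsetP; exists ((c, c), (c, d)); last by rewrite /q /= subrr mul0r.
  by rewrite inE cd andbT; apply/setXP; split; apply/setXP.
exists [set (a + (r + 1) * b)%R | a in M, b in M].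
  move=> _ /imset2P[a b aM bM ->].
  have -> : 6 * e + 6 * g = e + ((4 * e + 4 * g) + 0 + g + e) + g by lia.
  apply: near_invariantD => //; first exact: hM.
  apply: near_invariantM; last exact: hM.
  by apply: near_invariantD => //; [exact: hR | exact: near_invariant1].
right; rewrite -mulnn -cardsX.
apply: (@card_le_inj _ _ _ _ (fun z : 'F_p * 'F_p => (z.1 + (r + 1) * z.2)%R)).
  move=> [a b] [a' b'] /setXP[/= aM bM] /setXP[/= aM' bM'] e1.
  have bb : b = b'.
    (* A collision with [b != b'] would give [r + 1 = (a - a') / (b' - b)], an element of [R]. *)
    apply/eqP; apply: contraNT r1R => bb.
    apply/imsetP; exists ((a, a'), (b', b)).
      by rewrite inE eq_sym bb andbT; apply/setXP; split; apply/setXP.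
    have nz : (b' - b != 0)%R by rewrite subr_eq0 eq_sym.
    apply/(mulIf nz); rewrite /q /= divfK //.
    rewrite (_ : (a - a' = a + (r + 1) * b - a' - (r + 1) * b)%R); last by ring.
    by rewrite e1; ring.
  by move: e1; rewrite bb => /addIr ->.
by move=> [a b] /setXP[/= aM bM]; apply: imset2_f.
Qed.

(** Each [l] yields dense [A_l], [B_l] with [A_l + l B_l] small. Many of these pairs overlap one
    fixed pair, at [l0], so the ratios [l / l0] almost preserve a common [G]. The set produced by
    [pivot] from them must obey the energy bound; [m^2 <= 16 * p] serves the case where it is as
    large as the field. *)
Theorem few_additive_dilates : exists c : nat,
  forall (p K m : nat) (V L : {set 'F_p}),
  prime p -> 1 < K -> 0 < m -> m ^ 2 <= 16 * p -> #|V| <= m -> (0%R \notin L) ->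
  m <= K * #|L| ->
  (forall l, l \in L -> exists2 S : {set 'F_p}, #|S| <= m &
     m ^ 2 <= K * #|[set z in setX V V | (z.1 + l * z.2)%R \in S]|) ->
  m <= K ^ c.
Proof.
(* [12288 * K ^ 5 <= K ^ 19].  In terms of [J], the exponents are 135 for the
   elements of [M] and 11 for [G + G], hence [6 * 135 + 6 * 11 = 876] for those
   produced by [pivot] and [887 = 876 + 11] for the size of [G + c G]. *)
exists (19 * 910) => p K m V L pr_p K1 m0 mp Vm L0 mL hL.
set J := 12288 * K ^ 5.
have K5 : 0 < K ^ 5 by rewrite expn_gt0 (ltnW K1).
have J1 : 1 < J by apply: leq_trans (_ : 2 * K ^ 5 <= _); rewrite ?leq_mul2r ?orbT // -{1}[2]muln1 leq_mul2l.
have J0 : 0 < J by exact: ltnW.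
have KJ : K <= J.
  rewrite /J -[X in X <= _]mul1n leq_mul // -[X in X <= _]expn1 leq_pexp2l; lia.
suff : m <= J ^ 910.
  move=> h; apply: leq_trans h _; rewrite expnM leq_exp2r // /J.
  apply: (@leq_trans (K ^ 14 * K ^ 5)); last by rewrite -expnD.
  rewrite leq_mul2r; apply/orP; right.
  by apply: (@leq_trans (2 ^ 14)); [|rewrite leq_exp2r].
pose Q l (AB : {set 'F_p} * {set 'F_p}) := [&& AB.1 \subset V, AB.2 \subset V,
  m <= J * #|AB.1|, m <= J * #|AB.2| & #|AB.1 :+: dilate l AB.2| <= J * m].
pose rep l := odflt (set0, set0) [pick AB | Q l AB].
have {rep} [rep repP] : exists rep, forall l, l \in L -> Q l (rep l).
  exists rep => l lL; have [S Sm hS] := hL l lL.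
  have l0 : l != 0%R by apply: contraNneq L0 => <-.
  have [A [B [h1 h2 h3 h4 h5]]] := bsg_sumset l0 m0 Vm Sm hS.
  rewrite /rep; case: pickP => // /(_ (A, B)).
  by rewrite /Q /= h1 h2 h3 h4 h5.
have Lne : L != set0.
  by rewrite -card_gt0; case: posnP mL => // ->; rewrite muln0; lia.
(* Working with the products [A_l * B_l] inside [V * V] makes both factors overlap at once. *)
have [|||||l0 l0L [L' [L'L cardL' hL']]] := @popular_intersection _ _ L (setX V V)
  (fun l => setX (rep l).1 (rep l).2) (m ^ 2) (J ^ 2).
- by rewrite expn_gt0 m0.
- exact: Lne.
- by rewrite cardsX -mulnn leq_mul.
- by move=> l /repP /and5P[h1 h2 _ _ _]; apply: setXS.
- move=> l /repP /and5P[_ _ h1 h2 _].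
  by rewrite cardsX -!mulnn mulnACA leq_mul.
have /and5P[AV BV mA mB AB] := repP _ l0L.
set A := (rep l0).1 in AV mA AB; set B := (rep l0).2 in BV mB AB.
have l0n : l0 != 0%R by apply: contraNneq L0 => <-.
set Y := dilate l0 B in AB.
have Am : #|A| <= m by apply: leq_trans Vm; apply: subset_leq_card.
have Bm : #|B| <= m by apply: leq_trans Vm; apply: subset_leq_card.
have mY : m <= J * #|Y| by rewrite card_dilate.
pose M := [set (l / l0)%R | l in L'].
have cardM : #|M| = #|L'| by apply: card_imset; apply: mulIf; rewrite invr_eq0.
pose G := Y :+: dilate (-1) Y.
have hM c : c \in M -> near_invariant G J 135 c.
  case/imsetP => l lL' ->.
  have /and5P[h1 h2 h3 h4 h5] := repP _ (subsetP L'L _ lL').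
  have := hL' _ lL'.
  rewrite setX_setI cardsX -/A -/B.
  set A' := (rep l).1 :&: A; set B' := (rep l).2 :&: B => hAB.
  have J45 : 2 * (J ^ 2) ^ 2 <= J ^ 5 by rewrite -expnM (expnS J 4) leq_mul2r J1 orbT.
  have A'm : #|A'| <= m by apply: leq_trans Am; rewrite subset_leq_card // subsetIr.
  have B'm : #|B'| <= m by apply: leq_trans Bm; rewrite subset_leq_card // subsetIr.
  have hAB' : m * m <= J ^ 5 * (#|A'| * #|B'|).
    by rewrite mulnn; apply: leq_trans hAB _; rewrite leq_mul2r J45 orbT.
  apply: (@near_invariant_of_partial _ A Y m J m0 Am mA mY AB A' (dilate l0 B')).
  - exact: subsetIr.
  - exact/dilateS/subsetIr.
  - rewrite -(leq_pmul2r m0); apply: leq_trans hAB' _.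
    by rewrite mulnA leq_mul2l B'm orbT.
  - rewrite card_dilate // -(leq_pmul2r m0); apply: leq_trans hAB' _.
    by rewrite mulnCA mulnC leq_mul2l A'm orbT.
  - rewrite dilate_dilate divfK //; apply: leq_trans h5.
    by apply/subset_leq_card/sumsetSS; [|apply: dilateS]; exact: subsetIl.
have Gd : covered (J ^ 11) (G :+: G) G by apply: (difference_double m0 Am mA mY AB).
have Gle : #|G| <= J ^ 10 * m by apply: (card_difference_le m0 Am mA mY AB).
have Gge : m <= J * #|G| by apply: (card_difference_ge m0 mY).
have Gsym : dilate (-1) G = G by apply: dilateN_diff.
have G0 : G != set0 by rewrite -card_gt0; case: posnP Gge => // ->; rewrite muln0 leqNgt m0.
have pJ (i j : nat) : i <= j -> J ^ i <= J ^ j by apply: leq_pexp2l.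
have mM : m <= J ^ 6 * #|M|.
  apply: leq_trans mL _; rewrite cardM.
  apply: leq_trans (leq_mul KJ cardL') _; rewrite mulnA leq_mul2r; apply/orP; right.
  by rewrite -expnM (expnS J 5) leq_mul2l (expnS J 4) leq_mul2r J1 !orbT.
have [M1|M2] := leqP #|M| 1.
  apply: leq_trans mM _; apply: leq_trans (leq_mul (leqnn _) M1) _.
  by rewrite muln1; apply: pJ.
have [S hS bigS] := pivot pr_p J0 G0 Gsym Gd M2 hM.
have hS' c : c \in S -> #|G :+: dilate c G| <= J ^ 887 * #|G|.
  by move=> /hS h; apply: leq_trans (card_near_invariant Gd h) _.
(* The energy count requires [G] to be large compared with the doubling factor; otherwise
   [m <= J * #|G|] already suffices. *)
have [Gsmall|Gbig] := ltnP #|G| (2 * J ^ 887).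
  apply: leq_trans Gge _; apply: leq_trans (leq_mul (leqnn _) (ltnW Gsmall)) _.
  apply: (@leq_trans (J ^ (1 + (1 + 887)))); last exact: pJ.
  by rewrite expnD expn1 leq_mul2l expnD expn1 leq_mul2r J1 !orbT.
have Sle : #|S| <= J ^ 898 * m.
  apply: leq_trans (card_small_dilates_le G0 Gbig hS') _.
  apply: leq_trans (leq_mul (leqnn _) Gle) _.
  rewrite mulnA leq_mul2r (expnD J 888 10) leq_mul2r; apply/orP; right; apply/orP; right.
  by rewrite (expnS J 887) leq_mul2r J1 orbT.
rewrite -(leq_pmul2r m0).
case: bigS => bigS.
  rewrite mulnn; apply: leq_trans mp _.
  apply: leq_trans (leq_mul (leqnn _) (leq_trans bigS Sle)) _.
  rewrite mulnA leq_mul2r; apply/orP; right.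
  apply: (@leq_trans (J ^ (4 + 898))); last exact: pJ.
  rewrite expnD leq_mul2r; apply/orP; right.
  by apply: (@leq_trans (2 ^ 4)); rewrite ?leq_exp2r.
rewrite mulnn; apply: (@leq_trans ((J ^ 6 * #|M|) ^ 2)); first by rewrite leq_sqr.
rewrite expnMn -expnM (expnD J 12 898) -mulnA leq_mul2l; apply/orP; right.
exact: leq_trans bigS Sle.
Qed.

(** * Incidences on a grid *)

Lemma sum_card_cube (S T : finType) (L : {set S}) (A : {set T}) (r : T -> S -> bool) :
  \sum_(l in L) #|[set x in A | r x l]| ^ 3 =
  \sum_(z in setX A A) \sum_(x in A) #|[set l in L | [&& r z.1 l, r z.2 l & r x l]]|.
Proof.
have cube l : #|[set x in A | r x l]| ^ 3 =
    \sum_(z in setX A A) \sum_(x in A) [&& r z.1 l, r z.2 l & r x l].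
  rewrite !expnS expn0 muln1 !card_set_sum.
  rewrite (eq_bigl (fun z : T * T => (z.1 \in A) && (z.2 \in A))); last first.
    by case=> x y; rewrite in_setX.
  rewrite -(pair_big (mem A) (mem A)
    (fun x y => \sum_(z in A) [&& r x l, r y l & r z l] : nat)) /=.
  rewrite big_distrl /=; apply: eq_bigr => x _.
  rewrite big_distrl big_distrr /=; apply: eq_bigr => y _.
  rewrite !big_distrr /=; apply: eq_bigr => z _.
  by case: (r x l); case: (r y l); case: (r z l).
under eq_bigr do rewrite cube.
rewrite exchange_big /=; apply: eq_bigr => z _; rewrite exchange_big /=.
by apply: eq_bigr => x _; rewrite card_set_sum.
Qed.

(* Two points of a line determine the ordinate of its third point, as an affine
   combination whose ratio of weights depends only on the three abscissae. *)
Lemma grid_dilates (F : finFieldType) (A B : {set F}) (L : {set F * F}) (m K : nat) :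
  0 < K -> 16 * K ^ 3 <= m -> #|A| <= m -> #|L| <= m ^ 2 ->
  m ^ 3 <= K * \sum_(l in L) #|[set x in A | (l.1 * x + l.2)%R \in B]| ->
  exists D : {set F}, [/\ (0%R \notin D), m <= 8 * K ^ 3 * #|D|
    & forall c, c \in D -> exists2 S : {set F}, #|S| <= #|B| &
      m ^ 2 <= 8 * K ^ 3 * #|[set z in setX B B | (z.1 + c * z.2)%R \in S]|].
Proof.
move=> K0 mK Am Lm mT.
have K3 : 0 < K ^ 3 by rewrite expn_gt0 K0.
have m0 : 0 < m by lia.
pose inc (x : F) (l : F * F) := (l.1 * x + l.2)%R \in B.
pose w x1 x2 x := #|[set l in L | [&& inc x1 l, inc x2 l & inc x l]]|.
pose n (z : F * F) := \sum_(x in A) w z.1 z.2 x.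
have wm x1 x2 x : w x1 x2 x <= m ^ 2.
  by apply: leq_trans Lm; apply: subset_leq_card; apply/subsetP => l; rewrite inE => /andP[].
(* Cubes of the incidence counts enumerate triples of columns together with a line meeting the grid
   in all three. *)
have cubes : m ^ 5 <= K ^ 3 * \sum_(z in setX A A) n z.
  rewrite -(sum_card_cube L A inc).
  have := sum_cube_le L (fun l => #|[set x in A | inc x l]|).
  move: mT; move: (\sum_(l in L) #|_|) (\sum_(l in L) #|_| ^ 3) => x y mx xy.
  have h1 : (m ^ 3) ^ 3 <= (K * x) ^ 3 by rewrite leq_exp2r.
  have h2 : x ^ 3 <= (m ^ 2) ^ 2 * y.
    by apply: leq_trans xy _; rewrite leq_mul2r leq_sqr Lm orbT.
  have m4 : 0 < m ^ 4 by rewrite expn_gt0 m0.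
  rewrite -(leq_pmul2l m4) -expnD.
  rewrite -expnM in h1; apply: leq_trans h1 _.
  rewrite expnMn; apply: leq_trans (leq_mul (leqnn _) h2) _.
  by rewrite -expnM mulnCA.
pose D := [set z in setX A A | z.1 != z.2].
have offdiag : m ^ 5 <= 2 * K ^ 3 * \sum_(z in D) n z.
  (* Triples with [x1 = x2] number at most [m^4], which is negligible because [16 * K^3 <= m]. *)
  have diag : \sum_(z in setX A A | z \notin D) n z <= m ^ 4.
    apply: (@leq_trans (\sum_(z in setX A A | z \notin D) m ^ 3)).
      apply: leq_sum => z _; apply: (@leq_trans (\sum_(x in A) m ^ 2)).
        exact: leq_sum.
      by rewrite sum_nat_const (expnS m 2) leq_mul2r Am orbT.
    rewrite sum_nat_const (expnS m 3) leq_mul2r; apply/orP; right.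
    rewrite (_ : #|_| = #|[set z in setX A A | z \notin D]|); last first.
      by apply: eq_card => z; rewrite [RHS]inE.
    apply: leq_trans Am; apply: (@card_le_inj _ _ [set z in setX A A | z \notin D] A fst).
      move=> [x y] [x' y']; rewrite !inE /= => /andP[/andP[-> ->] /=].
      rewrite negbK => /eqP -> /andP[/andP[-> ->] /=].
      by rewrite negbK => /eqP -> ->.
    by move=> [x y]; rewrite !inE => /andP[/andP[]].
  move: cubes; rewrite (bigID [in D]) /=.
  rewrite (eq_bigl [in D]); last first.
    move=> z /=; case: (boolP (z \in D)) => [|_]; last by rewrite andbF.
    by rewrite andbT inE => /andP[].
  set x := \sum_(z in D) _; move: diag; set y := \sum_(z in _ | _) _ => diag.
  have : 16 * K ^ 3 * y <= m ^ 5 by rewrite (expnS m 4) leq_mul.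
  move: (K ^ 3) => k; move: (m ^ 5) => M; nia.
have D0 : D != set0.
  apply/eqP => D0; move: offdiag; rewrite D0 big_set0 muln0 leqn0 expn_eq0; lia.
have [[x1 x2] xD xmax] := exists_ge_average n D0.
move: xD; rewrite inE /= => /andP[_ x12].
set N := n (x1, x2) in xmax.
have N_ge : m ^ 3 <= 2 * K ^ 3 * N.
  have Dm : #|D| <= m ^ 2.
    apply: (@leq_trans #|setX A A|); last by rewrite cardsX -mulnn leq_mul.
    by apply: subset_leq_card; apply/subsetP => z; rewrite inE => /andP[].
  have m2 : 0 < m ^ 2 by rewrite expn_gt0 m0.
  rewrite -(leq_pmul2l m2) -expnD; apply: leq_trans offdiag _.
  rewrite mulnCA leq_mul2l; apply/orP; right; apply: leq_trans xmax _.
  by rewrite leq_mul2r Dm orbT.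
pose A' := [set x in A | N <= 2 * m * w x1 x2 x].
have A'_ge : m <= 4 * K ^ 3 * #|A'|.
  have h := sum_popular Am (leqnn N).
  have h2 : \sum_(x in A') w x1 x2 x <= #|A'| * m ^ 2.
    by rewrite -sum_nat_const; apply: leq_sum.
  have m2 : 0 < m ^ 2 by rewrite expn_gt0 m0.
  rewrite -(leq_pmul2l m2) -expnSr; apply: leq_trans N_ge _.
  have {}h : N <= 2 * (#|A'| * m ^ 2) by apply: leq_trans h _; rewrite leq_mul2l h2 orbT.
  apply: leq_trans (leq_mul (leqnn _) h) _; lia.
have w_ge x : x \in A' -> m ^ 2 <= 4 * K ^ 3 * w x1 x2 x.
  rewrite inE => /andP[_ h]; rewrite -(leq_pmul2l m0) -expnS.
  by apply: leq_trans N_ge _; apply: leq_trans (leq_mul (leqnn _) h) _; lia.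
(* The columns [x1] and [x2] themselves would give [c = 0] and a zero denominator. *)
pose A'' := A' :\: [set x1; x2].
have A''_ge : m <= 8 * K ^ 3 * #|A''|.
  have h : #|A'| <= 2 + #|A''|.
    rewrite -(cardsID [set x1; x2] A'); apply: leq_add => //.
    by apply: leq_trans (subset_leq_card (subsetIr _ _)) _; rewrite cards2; case: (_ != _).
  have := leq_mul (leqnn (4 * K ^ 3)) h; lia.
have x21 : (x2 - x1 != 0)%R by rewrite subr_eq0 eq_sym.
have ne x : x \in A'' -> (x - x1 != 0)%R /\ (x2 - x != 0)%R.
  by rewrite !inE negb_or !subr_eq0 (eq_sym x2) => /andP[/andP[-> ->]].
exists [set ((x - x1) / (x2 - x))%R | x in A'']; split.
- apply/imsetP => -[x /ne[h1 h2]] /esym/eqP.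
  by rewrite mulf_eq0 invr_eq0 (negbTE h1) (negbTE h2).
- rewrite card_in_imset // => x x' /ne[h1 h2] /ne[h1' h2'] /(congr1 (fun y => y + 1)%R).
  (* Adding [1] to [c] leaves a constant numerator, so [c] determines the column. *)
  have shift y : (x2 - y != 0 -> (y - x1) / (x2 - y) + 1 = (x2 - x1) / (x2 - y))%R.
    by move=> h; field.
  by rewrite !shift // => /(mulfI x21)/invr_inj/addrI/oppr_inj.
- move=> _ /imsetP[x xA ->]; have [h1 h2] := ne _ xA.
  (* Interpolation on a line gives [y1 + c y2 = (x2 - x1) / (x2 - x) * y], where [y] is its ordinate
     in column [x], an element of [B]. *)
  exists (dilate ((x2 - x1) / (x2 - x)) B); first exact: card_dilate_le.
  have xA' : x \in A' by move: xA; rewrite inE => /andP[].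
  apply: leq_trans (w_ge _ xA') _; apply: leq_mul; first by rewrite leq_mul2r orbT.
  apply: (@card_le_inj _ _ _ _ (fun l : F * F => (l.1 * x1 + l.2, l.1 * x2 + l.2)%R)).
    move=> [a b] [a' b'] _ _ /= [e1 e2].
    have aa : a = a'.
      apply: (mulIf x21); rewrite !mulrBr.
      rewrite (_ : (a * x2 - a * x1 = a * x2 + b - (a * x1 + b))%R); last by ring.
      by rewrite e1 e2; ring.
    by move: e1; rewrite aa => /addrI ->.
  move=> [a b]; rewrite !inE /inc /= => /andP[_ /and3P[-> -> hx]] /=.
  apply/imsetP; exists (a * x + b)%R => //.
  by field.
Qed.

Theorem grid_incidences : exists c : nat,
  forall (p K m : nat) (A B : {set 'F_p}) (L : {set 'F_p * 'F_p}),
  prime p -> 1 < K -> m ^ 2 <= 16 * p ->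
  #|A| <= m -> #|B| <= m -> #|L| <= m ^ 2 ->
  m ^ 3 <= K * \sum_(l in L) #|[set x in A | (l.1 * x + l.2)%R \in B]| ->
  m <= K ^ c.
Proof.
have [c hc] := few_additive_dilates.
(* The [7] covers [m < 16 * K^3], as [16 <= K^4]; the [6] comes from [8 * K^3 <= K^6]. *)
exists (7 + 6 * c) => p K m A B L pr_p K1 mp Am Bm Lm mT.
have K0 : 0 < K by exact: ltnW.
have [mK|mK] := leqP (16 * K ^ 3) m; last first.
  apply: leq_trans (ltnW mK) _; apply: (@leq_trans (K ^ 7)); last first.
    by rewrite leq_pexp2l // leq_addr.
  rewrite (expnD K 4 3) leq_mul2r; apply/orP; right.
  by apply: (@leq_trans (2 ^ 4)); rewrite ?leq_exp2r.
have [D [D0 mD hD]] := grid_dilates K0 mK Am Lm mT.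
have K3 : 0 < K ^ 3 by rewrite expn_gt0 K0.
have m0 : 0 < m by lia.
have K8 : 1 < 8 * K ^ 3 by lia.
have h : m <= (8 * K ^ 3) ^ c.
  apply: (hc p _ m B D) => // l /hD[S SB mS].
  by exists S => //; apply: leq_trans SB Bm.
apply: leq_trans h _; apply: (@leq_trans ((K ^ 6) ^ c)).
  case: (posnP c) => [->//|c0]; rewrite leq_exp2r // (expnD K 3 3) leq_mul2r.
  by apply/orP; right; apply: (@leq_trans (2 ^ 3)); rewrite ?leq_exp2r.
by rewrite -expnM leq_pexp2l // leq_addl.
Qed.

(** * Rich pairs of points *)

Section LinearSpace.
Variables (T : finType) (R : rel T).
Hypothesis R_sym : symmetric R.
Hypothesis R_K22 : forall a a' b b', a != a' -> R a b -> R a b' -> R a' b -> R a' b' -> b = b'.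

Definition degree_in (P : {set T}) (x : T) := #|[set y in P | R x y]|.
Definition edges_in (P : {set T}) := \sum_(x in P) degree_in P x.

(** Two elements of [H] have at most one common neighbour, so Cauchy-Schwarz gives
    [I^2 <= m^2 (I + #|H|^2)]. Since [2 m #|H| <= I], the last term is at most [I^2 / 4]. *)
Lemma high_degree_edges (P H : {set T}) (m : nat) :
  #|P| <= m ^ 2 -> H \subset P ->
  (forall x, x \in H -> 2 * m <= degree_in P x) ->
  \sum_(x in H) degree_in P x <= 2 * m ^ 2.
Proof.
move=> Pm HP Hdeg; set I := \sum_(x in H) _.
have dH : \sum_(x in P) degree_in H x = I.
  rewrite /I /degree_in; under eq_bigr do rewrite card_set_sum.
  rewrite exchange_big /=; apply: eq_bigr => x _; rewrite -card_set_sum.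
  by apply: eq_card => y; rewrite !inE R_sym.
have sq : \sum_(x in P) degree_in H x ^ 2 <= I + #|H| ^ 2.
  have -> : \sum_(x in P) degree_in H x ^ 2 =
      \sum_(y in H) \sum_(z in H) #|[set x in P | R x y && R x z]|.
    have sqx x : degree_in H x ^ 2 = \sum_(y in H) \sum_(z in H) (R x y && R x z).
      rewrite -mulnn /degree_in card_set_sum big_distrl /=; apply: eq_bigr => y _.
      rewrite big_distrr /=; apply: eq_bigr => z _.
      by case: (R x y); case: (R x z).
    under eq_bigr do rewrite sqx.
    rewrite exchange_big /=; apply: eq_bigr => y _; rewrite exchange_big /=.
    by apply: eq_bigr => z _; rewrite card_set_sum.
  rewrite -mulnn -sum_nat_const /I -big_split /=; apply: leq_sum => y yH.
  rewrite (bigD1 y) //=; apply: leq_add.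
    by apply: subset_leq_card; apply/subsetP => x; rewrite !inE R_sym andbb.
  apply: (@leq_trans (\sum_(z in H | z != y) 1)); last first.
    by rewrite sum1_card; apply/subset_leq_card/subsetP => z /andP[].
  apply: leq_sum => z /andP[_ zy]; rewrite leqNgt; apply/card_gt1P => -[a [b [+ + ab]]].
  rewrite !inE => /andP[_ /andP[ay az]] /andP[_ /andP[b_y bz]].
  by move: zy; rewrite (R_K22 ab az ay bz b_y) eqxx.
have := sum_sq_le P (degree_in H); rewrite dH => h.
have {}h : I ^ 2 <= m ^ 2 * (I + #|H| ^ 2).
  by apply: leq_trans h _; rewrite leq_mul.
have : 2 * m * #|H| <= I.
  by rewrite mulnC -sum_nat_const; apply: leq_sum.
move: {dH sq}I #|H| h => i k h1 h2.
have h3 : (2 * m * k) ^ 2 <= i ^ 2 by rewrite leq_sqr.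
have [->//|i0] := posnP i.
rewrite -(leq_pmul2l i0); nia.
Qed.

(** Deleting the elements of degree above [2 m] loses only edges that touch them. The degree bound
    later controls the sides of the grid. *)
Lemma truncate_degrees (P : {set T}) (m : nat) : #|P| <= m ^ 2 ->
  exists P' : {set T}, [/\ P' \subset P, forall x, x \in P' -> degree_in P' x <= 2 * m
    & edges_in P <= edges_in P' + 4 * m ^ 2].
Proof.
move=> Pm; pose H := [set x in P | 2 * m < degree_in P x].
have HP : H \subset P by apply/subsetP => x; rewrite inE => /andP[].
have highH := @high_degree_edges P H m Pm HP.
exists (P :\: H); split; first exact: subsetDl.
  move=> x; rewrite !inE => /andP[+ xP]; rewrite xP /= -leqNgt; apply: leq_trans.
  by apply: subset_leq_card; apply/subsetP => y; rewrite !inE => /andP[/andP[_ ->]].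
have {}highH : \sum_(x in H) degree_in P x <= 2 * m ^ 2.
  by apply: highH => x; rewrite inE => /andP[_ /ltnW].
have splitdeg x : degree_in P x = degree_in H x + degree_in (P :\: H) x.
  rewrite /degree_in -(cardsID H); congr (_ + _); apply: eq_card => y; rewrite !inE.
    by case: (y \in P); rewrite ?andbF //= ?andbT andbC.
  by case: (y \in P); rewrite ?andbF //= ?andbT andbC.
rewrite /edges_in (big_setID H) /= (setIidPr HP) addnC.
under eq_bigr do rewrite splitdeg.
rewrite big_split /=.
have : \sum_(x in P :\: H) degree_in H x <= \sum_(x in H) degree_in P x.
  rewrite /degree_in; under eq_bigr do rewrite card_set_sum.
  rewrite exchange_big /=; apply: leq_sum => x _; rewrite -card_set_sum.
  by apply: subset_leq_card; apply/subsetP => y; rewrite !inE R_sym => /andP[/andP[_ ->]].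
lia.
Qed.

(* Elements of [T] are both points and lines, with incidence [R]: [q], [z.1] and
   [z.2] are distinct lines through [p], the last two joining it to [a] and [b]. *)
Definition joined (P : {set T}) (a b p q : T) :=
  [exists z : T * T, [&& z.1 \in P, z.2 \in P, R p z.1, R a z.1, R p z.2, R b z.2,
     z.1 != q, z.2 != q, z.1 != z.2, a != p & b != p]].

(** Choose two further lines of [Q] through [p], then on each a point other than [p]. These points
    determine the two lines, since each is joined to [p] by only one, so distinct choices give
    distinct pairs. *)
Lemma card_joined (P Q : {set T}) (m K : nat) (p q : T) :
  Q \subset P -> (forall y, y \in Q -> m <= K * (degree_in P y).-1) ->
  p \in P -> q \in Q -> R p q ->
  (degree_in Q p - 2) ^ 2 * m ^ 2 <=
    K ^ 2 * #|[set z in setX P P | joined P z.1 z.2 p q]|.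
Proof.
move=> QP Qdeg pP qQ pq.
pose N := [set y in Q | R p y].
pose Y := [set y in setX N N | [&& y.1 != q, y.2 != q & y.1 != y.2]].
have qN : q \in N by rewrite inE qQ.
have Ycard : (degree_in Q p - 2) ^ 2 <= #|Y|.
  have -> : #|Y| = \sum_(y in N) #|[set y' in N | [&& y != q, y' != q & y != y']]|.
    exact: (card_pairs_sum N N (fun y y' => [&& y != q, y' != q & y != y'])).
  rewrite (bigID (fun y => y != q)) /=; apply: leq_trans (leq_addr _ _).
  apply: (@leq_trans (\sum_(y in N | y != q) (degree_in Q p - 2))).
    rewrite sum_nat_const -mulnn leq_mul2r; apply/orP; right.
    have -> : degree_in Q p = #|N| by [].
    rewrite (cardsD1 q N) qN (_ : #|[pred y in N | y != q]| = #|N :\ q|); first by lia.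
    by apply: eq_card => y; rewrite !inE andbC.
  apply: leq_sum => y /andP[yN yq].
  have -> : degree_in Q p = #|N| by [].
  rewrite (cardsD1 q N) qN (cardsD1 y (N :\ q)) !inE yq /=.
  move: yN; rewrite inE => -> /=; rewrite addnA addKn.
  apply: subset_leq_card; apply/subsetP => y'; rewrite !inE (eq_sym y).
  by case/and4P=> -> -> -> ->.
pose U y := [set z in P | R y z] :\ p.
have Ucard y : y \in N -> m <= K * #|U y|.
  rewrite inE => /andP[yQ py]; apply: leq_trans (Qdeg y yQ) _.
  by rewrite /degree_in (cardsD1 p) inE pP R_sym py.
pose W := [set w in setX Y (setX P P) | (w.2.1 \in U w.1.1) && (w.2.2 \in U w.1.2)].
have Wlow : #|Y| * m ^ 2 <= K ^ 2 * #|W|.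
  have -> : #|W| = \sum_(y in Y) #|[set z in setX P P | (z.1 \in U y.1) && (z.2 \in U y.2)]|.
    exact: (card_pairs_sum Y (setX P P) (fun y z => (z.1 \in U y.1) && (z.2 \in U y.2))).
  rewrite big_distrr /= -sum_nat_const; apply: leq_sum => -[y y'].
  rewrite inE => /andP[/setXP[/= yN y'N] _].
  apply: (@leq_trans (K ^ 2 * #|setX (U y) (U y')|)).
    by rewrite cardsX -!mulnn mulnACA leq_mul ?Ucard.
  rewrite leq_mul2l; apply/orP; right; apply: subset_leq_card; apply/subsetP => -[z z'].
  by rewrite !inE /= => /andP[/and3P[-> -> ->] /and3P[-> -> ->]].
apply: leq_trans (_ : #|Y| * m ^ 2 <= _); first by rewrite leq_mul2r Ycard orbT.
apply: leq_trans Wlow _; rewrite leq_mul2l; apply/orP; right.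
apply: (@card_le_inj _ _ _ _ snd).
  move=> [[y y'] [z z']] [[x x'] [w w']]; rewrite !inE /=.
  case/and3P=> /andP[/andP[/andP[/andP[_ py] /andP[_ py']] _] _] /and3P[zp _ yz] /and3P[zp' _ yz'].
  case/and3P=> /andP[/andP[/andP[/andP[_ px] /andP[_ px']] _] _] /and3P[_ _ xz] /and3P[_ _ xz'].
  move=> [e e']; subst w w'.
  rewrite R_sym in yz; rewrite R_sym in yz'; rewrite R_sym in xz; rewrite R_sym in xz'.
  by rewrite (R_K22 zp yz xz py px) (R_K22 zp' yz' xz' py' px').
move=> [[y y'] [z z']]; rewrite !inE /=.
case/andP=> /andP[/andP[/andP[/andP[yQ py] /andP[y'Q py']] /and3P[yq y'q yy']] _].
move=> /andP[/and3P[zp zP yz] /and3P[zp' z'P yz']].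
rewrite zP z'P; apply/existsP; exists (y, y') => /=.
by rewrite !(subsetP QP) // py py' yq y'q yy' zp zp' (R_sym z) yz (R_sym z') yz'.
Qed.

(** Restrict to the rich lines [Q], which carry half the incidences. By [card_joined] the pairs
    joined to flags at [p] number about [(d p)^3 m^2]; sum over [p] with the power mean inequality
    and average over the at most [m^4] pairs. *)
Lemma exists_rich_pair (P : {set T}) (m K : nat) :
  0 < K -> 8 * K <= m -> #|P| <= m ^ 2 -> m ^ 3 <= K * edges_in P ->
  exists a b, [/\ a \in P, b \in P & m ^ 3 <= 1024 * K ^ 5 *
    #|[set z in setX P P | R z.1 z.2 && joined P a b z.1 z.2]|].
Proof.
move=> K0 mK Pm mJ; set J := edges_in P in mJ.
have m0 : 0 < m by lia.
have J_ge : 8 * m ^ 2 <= J.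
  rewrite -(leq_pmul2l K0); apply: leq_trans mJ.
  by rewrite (expnS m 2) mulnCA mulnA leq_mul2r mK orbT.
pose Q := [set y in P | J <= 2 * m ^ 2 * degree_in P y].
have QP : Q \subset P by apply/subsetP => y; rewrite inE => /andP[].
have JQ : J <= 2 * \sum_(y in Q) degree_in P y by apply: sum_popular.
have Qdeg y : y \in Q -> m <= 4 * K * (degree_in P y).-1.
  rewrite inE => /andP[_ h].
  have m2 : 0 < m ^ 2 by rewrite expn_gt0 m0.
  have : m <= 2 * K * degree_in P y.
    rewrite -(leq_pmul2l m2) -expnSr; apply: leq_trans mJ _.
    by apply: leq_trans (leq_mul (leqnn K) h) _; lia.
  case: (degree_in P y) => [|d] /=; nia.
(* The [2] leaves room for [q] and the first of the two other lines; the total loss of at most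
   [2 m^2] is absorbed by [J_ge]. *)
pose d p := degree_in Q p - 2.
have sumd : J <= 4 * \sum_(p in P) d p.
  have : \sum_(p in P) degree_in Q p = \sum_(y in Q) degree_in P y.
    rewrite /degree_in; under eq_bigr do rewrite card_set_sum.
    rewrite exchange_big /=; apply: eq_bigr => y _; rewrite -card_set_sum.
    by apply: eq_card => x; rewrite !inE R_sym.
  have : \sum_(p in P) degree_in Q p <= \sum_(p in P) (d p + 2).
    by apply: leq_sum => p _; rewrite /d; lia.
  by rewrite big_split /= sum_nat_const; lia.
have cubes : m ^ 5 <= 64 * K ^ 3 * \sum_(p in P) d p ^ 3.
  have := sum_cube_le P d; move: sumd.
  move: (\sum_(p in P) d p) (\sum_(p in P) d p ^ 3) => x y Jx xy.
  have h1 : (m ^ 3) ^ 3 <= (K * (4 * x)) ^ 3.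
    by rewrite leq_exp2r //; apply: leq_trans mJ _; rewrite leq_mul2l Jx orbT.
  have h2 : x ^ 3 <= (m ^ 2) ^ 2 * y.
    by apply: leq_trans xy _; rewrite leq_mul2r leq_sqr Pm orbT.
  have m4 : 0 < m ^ 4 by rewrite expn_gt0 m0.
  rewrite -(leq_pmul2l m4) -expnD.
  rewrite -expnM in h1; apply: leq_trans h1 _.
  rewrite !expnMn mulnA.
  by apply: leq_trans (leq_mul (leqnn _) h2) _; apply: eq_leq; ring.
pose W a b := #|[set z in setX P P | R z.1 z.2 && joined P a b z.1 z.2]|.
have total : m ^ 2 * \sum_(p in P) d p ^ 3 <= (4 * K) ^ 2 * \sum_(z in setX P P) W z.1 z.2.
  have -> : \sum_(z in setX P P) W z.1 z.2 =
    \sum_(w in setX P P) #|[set z in setX P P | R w.1 w.2 && joined P z.1 z.2 w.1 w.2]|.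
    rewrite /W; under eq_bigr do rewrite card_set_sum.
    by rewrite exchange_big /=; apply: eq_bigr => w _; rewrite card_set_sum.
  rewrite (eq_bigl (fun z : T * T => (z.1 \in P) && (z.2 \in P))); last first.
    by case=> x y; rewrite in_setX.
  rewrite -(pair_big (mem P) (mem P)
    (fun p q => #|[set z in setX P P | R p q && joined P z.1 z.2 p q]|)) /=.
  rewrite !big_distrr /=; apply: leq_sum => p pP.
  apply: (@leq_trans (\sum_(q in [set y in Q | R p y]) d p ^ 2 * m ^ 2)).
    rewrite sum_nat_const (expnS (d p) 2) mulnC -mulnA leq_mul2r; apply/orP; right.
    exact: leq_subr.
  rewrite big_distrr /= [X in _ <= X](big_setID [set y in Q | R p y]) /=.
  apply: leq_trans (leq_addr _ _); rewrite (setIidPr _); last first.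
    by apply/subsetP => y; rewrite inE => /andP[/(subsetP QP)].
  apply: leq_sum => q; rewrite inE => /andP[qQ pq]; rewrite pq /=.
  exact: card_joined.
have P0 : setX P P != set0.
  apply/eqP => P0; move: total; rewrite P0 big_set0 muln0 leqn0 muln_eq0 expn_eq0 /=.
  by case/orP=> [/andP[/eqP]|/eqP h]; [lia|move: cubes; rewrite h muln0 leqn0 expn_eq0; lia].
have [[a b] /setXP[/= aP bP] abmax] := exists_ge_average (fun z => W z.1 z.2) P0.
exists a, b; split => //; rewrite -/(W a b).
have {}abmax : \sum_(z in setX P P) W z.1 z.2 <= m ^ 4 * W a b.
  apply: leq_trans abmax _; rewrite leq_mul2r cardsX.
  by apply/orP; right; rewrite (expnD m 2 2) leq_mul.
have m4 : 0 < m ^ 4 by rewrite expn_gt0 m0.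
rewrite -(leq_pmul2l m4) -expnD (expnD m 2 5).
apply: leq_trans (leq_mul (leqnn _) cubes) _.
rewrite mulnCA; apply: leq_trans (leq_mul (leqnn _) total) _.
rewrite mulnA; apply: leq_trans (leq_mul (leqnn _) abmax) _.
by apply: eq_leq; ring.
Qed.

End LinearSpace.

(** * Projection to a grid *)

Section PolarLines.
Variables (F : finFieldType) (alpha : F).
Hypothesis alpha_neq0 : alpha != 0%R.
Local Open Scope ring_scope.

Definition dot2 (u v : F * F) : F := u.1 * v.1 + u.2 * v.2.
Definition polar : rel (F * F) := fun u v => dot2 u v == alpha.

Lemma polar_sym : symmetric polar.
Proof. by move=> u v; rewrite /polar /dot2 (mulrC u.1) (mulrC u.2). Qed.

(** Cramer's rule when [a] and [a'] are independent. When their determinant vanishes, the equations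
    give [alpha a = alpha a'], contradicting [a != a']. *)
Lemma polar_K22 (a a' b b' : F * F) :
  a != a' -> polar a b -> polar a b' -> polar a' b -> polar a' b' -> b = b'.
Proof.
move: a a' b b' => [a1 a2] [c1 c2] [b1 b2] [d1 d2] ac.
rewrite /polar /dot2 /= => /eqP e1 /eqP e2 /eqP e3 /eqP e4.
have [D0|D0] := eqVneq (a1 * c2 - a2 * c1) 0; last first.
  congr (_, _); apply: (mulfI D0).
    transitivity ((a1 * b1 + a2 * b2) * c2 - (c1 * b1 + c2 * b2) * a2); first by ring.
    by rewrite e1 e3 -{1}e2 -e4; ring.
  transitivity ((c1 * b1 + c2 * b2) * a1 - (a1 * b1 + a2 * b2) * c1); first by ring.
  by rewrite e1 e3 -{1}e4 -e2; ring.
case/negP: ac; apply/eqP; congr (_, _); apply: (mulfI alpha_neq0); apply/eqP; rewrite -subr_eq0.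
  have -> : alpha * a1 - alpha * c1 = (a1 * c2 - a2 * c1) * b2.
    by rewrite -{1}e3 -e1; ring.
  by rewrite D0 mul0r.
have -> : alpha * a2 - alpha * c2 = - (a1 * c2 - a2 * c1) * b1.
  by rewrite -{1}e3 -e1; ring.
by rewrite D0 oppr0 mul0r.
Qed.

(* The projective transformation sending [p1] and [p2] to the two directions at
   infinity: writing [p - p1 = s d + t e'] with [d = p2 - p1], the coordinates
   become [x = s / t] and [y = (s - 1) / t], and they are constant on the lines
   through [p1], respectively [p2]. *)
Lemma rich_pair_grid (P : {set F * F}) (p1 p2 : F * F) :
  let W := [set z in setX P P | polar z.1 z.2 && joined polar P p1 p2 z.1 z.2] in
  W != set0 ->
  exists (A B : {set F}) (L : {set F * F}),
    [/\ (#|A| <= degree_in polar P p1)%N, (#|B| <= degree_in polar P p2)%N,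
        (#|L| <= #|P|)%N
      & (#|W| <= \sum_(l in L) #|[set x in A | (l.1 * x + l.2)%R \in B]|)%N].
Proof.
move=> W W0.
have p12 : p1 != p2.
  case/set0Pn: W0 => -[p q]; rewrite inE /= => /andP[_ /andP[_ /existsP[[q1 q2] /=]]].
  case/and5P=> _ _ r1 r2 /and5P[r3 r4 _ _ /and3P[q12 pp _]].
  by apply: contraNneq q12 => e; rewrite -e in r4; rewrite (polar_K22 pp r2 r4 r1 r3).
pose d := (p2.1 - p1.1, p2.2 - p1.2).
(* A covector equal to [1] on [d]; the second basis vector is [(- e.2, e.1)]. *)
have [e ed] : exists e : F * F, e.1 * d.1 + e.2 * d.2 = 1.
  have [d1|d1] := eqVneq d.1 0; last by exists (d.1^-1, 0); rewrite /= mulVf // mul0r addr0.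
  have [d2|d2] := eqVneq d.2 0; last by exists (0, d.2^-1); rewrite /= mulVf // mul0r add0r.
  case/negP: p12; apply/eqP; rewrite (surjective_pairing p1) (surjective_pairing p2).
  by congr (_, _); apply/eqP; rewrite eq_sym -subr_eq0; apply/eqP.
pose s (p : F * F) := e.1 * (p.1 - p1.1) + e.2 * (p.2 - p1.2).
pose t (p : F * F) := d.1 * (p.2 - p1.2) - d.2 * (p.1 - p1.1).
(* In these coordinates the line of [q] is [s a + t b = c]. It contains [p1] when [c = 0] and [p2]
   when [c = a]. *)
pose a (q : F * F) := d.1 * q.1 + d.2 * q.2.
pose b (q : F * F) := e.1 * q.2 - e.2 * q.1.
pose c (q : F * F) := alpha - dot2 p1 q.
have decomp (u q : F * F) : dot2 u q = (e.1 * u.1 + e.2 * u.2) * a q + (d.1 * u.2 - d.2 * u.1) * b q.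
  rewrite /dot2 /a /b -[u.1 * q.1 + u.2 * q.2]mul1r -ed; ring.
have lineE p q : polar p q = (s p * a q + t p * b q == c q).
  rewrite /polar /c -(subr_eq0 _ alpha) -[in RHS]subr_eq0; congr (_ == _).
  have -> : s p * a q + t p * b q = dot2 p q - dot2 p1 q.
    by rewrite !decomp /s /t; ring.
  by ring.
have c_eq0 q : polar p1 q = (c q == 0) by rewrite /polar /c subr_eq0 eq_sym.
have c_eqa q : polar p2 q = (c q == a q).
  rewrite lineE (_ : s p2 = 1); last by rewrite /s -ed.
  by rewrite (_ : t p2 = 0) ?mul1r ?mul0r ?addr0 1?eq_sym // /t /d /=; ring.
have point_inj p p' : s p = s p' -> t p = t p' -> p = p'.
  have h1 u : u.1 - p1.1 = s u * d.1 - t u * e.2.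
    by rewrite -[LHS]mul1r -ed /s /t; ring.
  have h2 u : u.2 - p1.2 = s u * d.2 + t u * e.1.
    by rewrite -[LHS]mul1r -ed /s /t; ring.
  move=> es et; rewrite (surjective_pairing p) (surjective_pairing p'); congr (_, _).
    by apply: (addIr (- p1.1)); rewrite !h1 es et.
  by apply: (addIr (- p1.2)); rewrite !h2 es et.
have line_inj q q' : a q = a q' -> b q = b q' -> q = q'.
  move=> ea eb.
  have h u : dot2 u q = dot2 u q' by rewrite !decomp ea eb.
  have := h (1, 0); have := h (0, 1); rewrite /dot2 /= !mul1r !mul0r !addr0 !add0r.
  by rewrite (surjective_pairing q) (surjective_pairing q') /= => -> ->.
have ab_neq0 p q : polar p q -> ~ (a q = 0 /\ b q = 0).
  move=> /eqP pq [a0 b0]; case/negP: alpha_neq0.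
  by rewrite -pq decomp a0 b0 !mulr0 addr0.
(* Dividing the equation by [t c] and using [y = x - 1 / t] gives this slope and intercept. *)
pose l (q : F * F) := ((c q - a q) / c q, - (b q / c q)).
pose A := [set - (b q / a q) | q in [set q in P | polar p1 q]].
pose B := [set - (b q / a q) | q in [set q in P | polar p2 q]].
pose L := [set l q | q in P].
have onW p q : (p, q) \in W -> [/\ t p != 0, c q != 0, s p * a q + t p * b q = c q,
    s p / t p \in A & (s p - 1) / t p \in B].
  rewrite inE /= => /andP[/setXP[/= pP qP] /andP[pq /existsP[[q1 q2] /=]]].
  case/and5P=> q1P q2P r1 r2 /and5P[r3 r4 n1 n2 /and3P[n3 m1 m2]].
  (* A point with [t p = 0] lies on the line [p1 p2], which would force [q1 = q2]. *)
  have tp : t p != 0.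
    apply: contraNneq n3 => t0.
    have c10 : c q1 = 0 by apply/eqP; rewrite -c_eq0.
    have a10 : a q1 = 0.
      move: r1; rewrite lineE t0 mul0r addr0 c10 mulf_eq0 => /orP[/eqP s0|/eqP //].
      case/negP: m1; rewrite eq_sym; apply/eqP; apply: point_inj; rewrite ?s0 ?t0 /s /t; ring.
    have r5 : polar p2 q1 by rewrite c_eqa c10 a10.
    by rewrite (polar_K22 m2 r5 r4 r1 r3).
  (* Otherwise [q] also joins [p] to [p1], so it equals [q1]. *)
  have cq : c q != 0.
    rewrite -c_eq0; apply: contraNN n1 => r5.
    by rewrite (polar_K22 m1 r2 r5 r1 pq).
  split=> //; first by apply/eqP; rewrite -lineE.
    apply/imsetP; exists q1; first by rewrite inE q1P.
    have c10 : c q1 = 0 by apply/eqP; rewrite -c_eq0.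
    move: (r1); rewrite lineE c10 addr_eq0 => /eqP h.
    have a1 : a q1 != 0.
      apply/eqP => a0; apply: (ab_neq0 _ _ r1); split=> //.
      by apply: (mulfI tp); apply/eqP; rewrite mulr0 -oppr_eq0 -h a0 mulr0.
    by apply/eqP; rewrite -mulNr eqr_div // h mulNr (mulrC (t p)).
  apply/imsetP; exists q2; first by rewrite inE q2P.
  have c2a : c q2 = a q2 by apply/eqP; rewrite -c_eqa.
  have h : (s p - 1) * a q2 = - (t p * b q2).
    apply/eqP; rewrite -addr_eq0; move: (r3); rewrite lineE c2a -subr_eq0 => /eqP h.
    by apply/eqP; rewrite -[RHS]h; ring.
  have a2 : a q2 != 0.
    apply/eqP => a0; apply: (ab_neq0 _ _ r3); split=> //.
    by apply: (mulfI tp); apply/eqP; rewrite mulr0 -oppr_eq0 -h a0 mulr0.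
  by apply/eqP; rewrite -mulNr eqr_div // h mulNr (mulrC (t p)).
have yE p q : (p, q) \in W -> (l q).1 * (s p / t p) + (l q).2 = (s p - 1) / t p.
  move=> /onW[tp cq h _ _]; rewrite /l /=.
  have -> : b q = (c q - s p * a q) / t p by rewrite -h; field.
  by field; rewrite tp cq.
exists A, B, L; split.
- exact: leq_imset_card.
- exact: leq_imset_card.
- exact: leq_imset_card.
have -> : (\sum_(l in L) #|[set x in A | (l.1 * x + l.2)%R \in B]| =
           #|[set w in setX L A | (w.1.1 * w.2 + w.1.2)%R \in B]|)%N.
  by rewrite (card_pairs_sum L A (fun l x => (l.1 * x + l.2)%R \in B)).
apply: (@card_le_inj _ _ _ _ (fun z : F * F * (F * F) => (l z.2, s z.1 / t z.1))); last first.
  move=> [p q] pqW; have [tp cq _ xA yB] := onW _ _ pqW.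
  rewrite inE /= yE // yB andbT; apply/setXP; split=> //.
  by apply: imset_f; move: pqW; rewrite inE => /andP[/setXP[]].
move=> [p q] [p' q'] pqW pqW' [e1 e2 ex].
have ey : (s p - 1) / t p = (s p' - 1) / t p'.
  by rewrite -(yE _ _ pqW) -(yE _ _ pqW') /= e1 e2 ex.
have [tp cq _ _ _] := onW _ _ pqW; have [tp' cq' _ _ _] := onW _ _ pqW'.
(* [x - y = 1 / t] recovers [t], and then [x] recovers [s]. *)
have et : t p = t p'.
  apply: invr_inj; transitivity (s p / t p - (s p - 1) / t p); first by ring.
  by rewrite ex ey; ring.
have es : s p = s p' by apply: (mulIf (invr_neq0 tp)); rewrite {2}et.
have ea : a q / c q = a q' / c q'.
  have slope u : c u != 0 -> (c u - a u) / c u = 1 - a u / c u by move=> cu; field.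
  by apply: oppr_inj; apply: (addrI 1); rewrite -!slope.
have eb : b q / c q = b q' / c q' by exact: oppr_inj.
(* The slope and intercept fix only [a / c] and [b / c]. The relation [alpha = c + dot2 p1 q]
   supplies the scale [c], as [alpha != 0]. *)
have ec : c q = c q'.
  apply: invr_inj; apply: (mulfI alpha_neq0).
  have hc u : c u != 0 -> alpha / c u = 1 + (e.1 * p1.1 + e.2 * p1.2) * (a u / c u)
      + (d.1 * p1.2 - d.2 * p1.1) * (b u / c u).
    move=> cu; have -> : alpha = c u + dot2 p1 u by rewrite /c; ring.
    by rewrite decomp; field.
  by rewrite !hc // ea eb.
have -> : p = p' by apply: point_inj.
by rewrite (line_inj q q') //; apply: (mulIf (invr_neq0 cq)); rewrite {2}ec.
Qed.

End PolarLines.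

(** Truncation bounds the degrees by [2 m], so a rich pair projects to a grid of side [2 m]; hence
    [4 * p] here against [16 * p] in [grid_incidences]. *)
Theorem polar_incidences : exists c : nat,
  forall (p K m : nat) (alpha : 'F_p) (P : {set 'F_p * 'F_p}),
  prime p -> alpha != 0%R -> 1 < K -> #|P| <= m ^ 2 -> m ^ 2 <= 4 * p ->
  m ^ 3 <= K * edges_in (polar alpha) P ->
  m <= K ^ c.
Proof.
have [c hc] := grid_incidences.
exists (5 + 23 * c) => p K m alpha P pr_p alpha0 K1 Pm mp mJ.
have K0 : 0 < K by exact: ltnW.
have [mK|mK] := leqP (16 * K) m; last first.
  apply: leq_trans (ltnW mK) _; apply: (@leq_trans (K ^ 5)); last first.
    by rewrite leq_pexp2l // leq_addr.
  rewrite (expnD K 4 1) expn1 leq_mul2r; apply/orP; right.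
  by apply: (@leq_trans (2 ^ 4)); rewrite ?leq_exp2r.
have [P' [P'P deg JJ]] := truncate_degrees (@polar_sym _ alpha) (polar_K22 alpha0) Pm.
have P'm : #|P'| <= m ^ 2 by apply: leq_trans Pm; apply: subset_leq_card.
have m0 : 0 < m by lia.
have mJ' : m ^ 3 <= 2 * K * edges_in (polar alpha) P'.
  have h1 : 8 * K * m ^ 2 <= m ^ 3 by rewrite (expnS m 2) leq_mul2r; apply/orP; right; lia.
  have h2 := leq_mul (leqnn K) JJ.
  have {h2} := leq_trans mJ h2; lia.
have K2 : 0 < 2 * K by lia.
have mK2 : 8 * (2 * K) <= m by lia.
have [a [b [aP bP rich]]] := exists_rich_pair (@polar_sym _ alpha) (polar_K22 alpha0) K2 mK2 P'm mJ'.
set W := [set z in _ | _] in rich.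
have W0 : W != set0.
  apply/eqP => W0; move: rich; rewrite W0 cards0 muln0 leqn0 expn_eq0; lia.
have [A [B [L [cA cB cL cW]]]] := rich_pair_grid alpha0 W0.
(* The factor [8] turns [m^3] into [(2 m)^3], and [2 K] is the constant left after truncation. *)
have [J JJ'] : exists J, J = 8 * (1024 * (2 * K) ^ 5) by exists (8 * (1024 * (2 * K) ^ 5)).
have JE : J = 2 ^ 18 * K ^ 5 by rewrite JJ'; ring.
have K5 : 0 < K ^ 5 by rewrite expn_gt0 K0.
have h : 2 * m <= J ^ c.
  apply: (hc p J (2 * m) A B L pr_p).
  - rewrite JE; apply: (@leq_trans (2 ^ 1 * K ^ 5)); first by rewrite leq_pmulr.
    by rewrite leq_mul2r leq_pexp2l ?orbT.
  - by rewrite expnMn; lia.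
  - exact: leq_trans cA (deg a aP).
  - exact: leq_trans cB (deg b bP).
  - by apply: leq_trans cL (leq_trans P'm _); rewrite leq_sqr; lia.
  - rewrite expnMn JJ' -mulnA leq_mul2l.
    by apply: leq_trans rich _; rewrite leq_mul2l cW orbT.
apply: (@leq_trans (2 * m)); first by rewrite leq_pmull.
apply: leq_trans h _; apply: (@leq_trans ((K ^ 23) ^ c)); last first.
  by rewrite -expnM leq_pexp2l // leq_addl.
case: (posnP c) => [->//|c0]; rewrite leq_exp2r // JE (expnD K 18 5) leq_mul2r.
by apply/orP; right; rewrite leq_exp2r.
Qed.

(** * Dot products *)

Section DotProducts.
Variables (F : finFieldType) (P : {set 'rV[F]_2}).
Local Open Scope ring_scope.

Definition coords (u : 'rV[F]_2) : F * F := (u 0 0, u 0 1).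

Lemma coords_inj : injective coords.
Proof.
move=> u v [e0 e1]; apply/rowP => j.
have [->|->] : j = 0 \/ j = 1 by case: j => [[|[|//]] h]; [left|right]; apply: val_inj.
  by [].
by [].
Qed.

Lemma dotp_coords (u v : 'rV[F]_2) : dotp u v = dot2 (coords u) (coords v).
Proof.
rewrite /dotp /dot2 /= !big_ord_recl big_ord0 addr0.
by rewrite (_ : lift ord0 ord0 = 1) //; apply: val_inj.
Qed.

Lemma card_polar_fiber (beta : F) (s : nat) (u : 'rV[F]_2) :
  u != 0 -> no_collinear s P -> (#|[set r in P | dotp u r == beta]| <= s)%N.
Proof.
move=> u0 hs; have [->|[r0]] := set_0Vmem [set r in P | dotp u r == beta].
  by rewrite cards0.
rewrite inE => /andP[_ /eqP er0].
(* The direction orthogonal to [u]: the solutions lie on the line through [r0] along it. *)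
pose v : 'rV[F]_2 := \row_j (if j == 0 then - u 0 1 else u 0 0).
have [v0 v1] : v 0 0 = - u 0 1 /\ v 0 1 = u 0 0 by rewrite !mxE.
have vn0 : v != 0.
  apply: contraNneq u0 => e; apply/eqP/coords_inj; rewrite /coords -v1 e !mxE.
  by congr (_, _); apply: oppr_inj; rewrite -v0 e mxE oppr0.
apply: leq_trans (ltnW (hs r0 v vn0)); apply/subset_leq_card/subsetP => r.
rewrite !inE => /andP[-> /eqP er] /=.
have h : u 0 0 * (r 0 0 - r0 0 0) + u 0 1 * (r 0 1 - r0 0 1) = 0.
  transitivity (dotp u r - dotp u r0); last by rewrite er er0 subrr.
  by rewrite !dotp_coords /dot2 /=; ring.
have [u00|u00] := eqVneq (u 0 0) 0; last first.
  apply/imsetP; exists ((r 0 1 - r0 0 1) / u 0 0) => //; apply: coords_inj.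
  rewrite /coords !mxE /=; congr (_, _); last by field.
  have -> : r 0 0 = r0 0 0 + (r 0 0 - r0 0 0) by ring.
  congr (_ + _); apply: (mulfI u00).
  have -> : u 0 0 * (r 0 0 - r0 0 0) = - (u 0 1 * (r 0 1 - r0 0 1)).
    by apply/eqP; rewrite -addr_eq0 h.
  by field.
have u01 : u 0 1 != 0.
  by apply: contraNneq u0 => u01; apply/eqP/coords_inj; rewrite /coords u00 u01 !mxE.
apply/imsetP; exists (- (r 0 0 - r0 0 0) / u 0 1) => //; apply: coords_inj.
rewrite /coords !mxE /= u00; congr (_, _); first by field.
move: h; rewrite u00 mul0r add0r => /eqP; rewrite mulf_eq0 (negbTE u01) subr_eq0 /= => /eqP ->.
by rewrite mulr0 addr0.
Qed.

(** For each pair counted by [edges_in], the third point lies on a line; [alpha != 0] makes its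
    normal vector nonzero. *)
Lemma card_Pi_dot_le (alpha beta : F) (s : nat) :
  alpha != 0 -> no_collinear s P ->
  (#|Pi_dot alpha beta P| <= s * edges_in (polar alpha) (coords @: P))%N.
Proof.
move=> alpha0 hs.
pose E := [set z in setX P P | dotp z.1 z.2 == alpha].
have -> : #|Pi_dot alpha beta P| = #|[set w in setX E P | dotp w.1.1 w.2 == beta]|.
  apply: eq_card => -[[u v] w]; rewrite !inE /=.
  by case: (u \in P); case: (v \in P); case: (w \in P); rewrite ?andbF ?andbT.
rewrite (card_pairs_sum E P (fun z r => dotp z.1 r == beta)).
apply: (@leq_trans (\sum_(z in E) s)%N).
  apply: leq_sum => -[u v]; rewrite inE /= => /andP[_ /eqP uv].
  apply: card_polar_fiber => //; apply: contraNneq alpha0 => u0.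
  by rewrite -uv /dotp big1 // => i _; rewrite u0 mxE mul0r.
rewrite sum_nat_const mulnC leq_mul2l; apply/orP; right.
rewrite /edges_in /degree_in -(card_pairs_sum (coords @: P) (coords @: P) (polar alpha)).
apply: (@card_le_inj _ _ _ _ (fun z => (coords z.1, coords z.2))).
  move=> [u v] [u' v'] _ _ e; congr (_, _); apply: coords_inj.
    exact: (congr1 fst e).
  exact: (congr1 snd e).
move=> [u v]; rewrite !inE /= => /andP[/andP[uP vP] uv].
by rewrite /polar -dotp_coords uv !imset_f.
Qed.

End DotProducts.

(** The integers [m] and [k] stand for [n^(1/2)] and [m^(1/c)]: each is the least one satisfying its
    lower bound. *)
Lemma Pi_dot_nat_bound : exists2 c : nat, 0 < c &
  forall (p s : nat) (P : {set 'rV['F_p]_2}) (alpha beta : 'F_p),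
  prime p -> 0 < #|P| -> #|P| < p -> no_collinear s P -> alpha != 0%R ->
  exists m k : nat, [/\ #|P| <= m ^ 2, m ^ 2 <= 4 * #|P|, m <= k ^ c
    & k * #|Pi_dot alpha beta P| <= 2 ^ c.+1 * s * m ^ 3].
Proof.
have [c0 hc] := polar_incidences.
exists c0.+1 => // p s P alpha beta pr_p P0 Pp hs alpha0; set c := c0.+1.
have exm : exists m, #|P| <= m ^ 2.
  by exists #|P|; rewrite -mulnn leq_pmulr.
case: (ex_minnP exm) => m Pm minm.
have m0 : 0 < m by case: m Pm {minm} => //; rewrite leqNgt P0.
have mP : m ^ 2 <= 4 * #|P|.
  have : m.-1 ^ 2 < #|P| by rewrite ltnNge; apply/negP => /minm; rewrite -ltnS prednK // ltnn.
  by move: m0 P0; case: (m) => // j _ /= ; nia.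
have exk : exists k, m <= k ^ c.
  by exists m; rewrite -[X in X <= _]expn1 leq_pexp2l.
case: (ex_minnP exk) => k mk mink.
have k0 : 0 < k by case: k mk {mink} => //; rewrite exp0n // leqNgt m0.
have k1 : k.-1 ^ c < m by rewrite ltnNge; apply/negP => /mink; rewrite -ltnS prednK // ltnn.
exists m, k; split => //.
set J := edges_in (polar alpha) (@coords _ @: P).
apply: leq_trans (leq_mul (leqnn k) (card_Pi_dot_le _ alpha0 hs)) _; rewrite -/J.
suff kJ : k * J <= 2 ^ c.+1 * m ^ 3 by rewrite mulnCA mulnAC (mulnC _ s) leq_mul2l kJ orbT.
have cardE : #|@coords _ @: P| = #|P| by apply: card_imset; apply: coords_inj.
(* [polar_incidences] is applied with [K = k - 1], which must exceed [1]. For [k <= 2] the trivial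
   bound [m^4] is enough, as [m <= 2^c]. *)
have [k2|k2] := leqP k 2.
  have mc : m <= 2 ^ c by apply: leq_trans mk _; rewrite leq_exp2r.
  have JP : J <= m ^ 2 * m ^ 2.
    apply: (@leq_trans (#|P| * #|P|)); last by rewrite leq_mul.
    rewrite -{1}cardE -sum_nat_const; apply: leq_sum => x _.
    rewrite -cardE; apply: subset_leq_card; apply/subsetP => y.
    by rewrite inE => /andP[].
  rewrite (expnS 2 c) -mulnA leq_mul //; rewrite -expnD in JP.
  by apply: leq_trans JP _; rewrite (expnS m 3) leq_mul2r mc orbT.
have kK : k <= 2 * k.-1 by lia.
have : k.-1 * J <= m ^ 3.
  rewrite leqNgt; apply/negP => /ltnW mJ.
  (* A large [J] would give [m <= (k - 1)^c], against the minimality of [k]. *)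
  have := hc p k.-1 m alpha (@coords _ @: P) pr_p alpha0.
  have h1 : 1 < k.-1 by lia.
  have h2 : m ^ 2 <= 4 * p by apply: leq_trans mP _; rewrite leq_mul2l (ltnW Pp) orbT.
  rewrite cardE => /(_ h1 Pm h2 mJ) h.
  have : m <= k.-1 ^ c by apply: leq_trans h _; rewrite leq_pexp2l // ltnW.
  by rewrite leqNgt k1.
move=> h; apply: leq_trans (leq_mul kK (leqnn J)) _; rewrite -mulnA.
by apply: leq_mul; rewrite // -{1}[2]expn1 leq_pexp2l.
Qed.

(** * From integer bounds to real exponents *)

Import Order.TTheory Num.Theory.
Local Open Scope ring_scope.

(** Take roots in [n <= m^2 <= k^(2 c)], and raise [m^2 <= 2^2 n] to the power [3/2]. *)
Lemma powR_half_le (R : realType) (n m k c : nat) :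
  (0 < c)%N -> (n <= m ^ 2)%N -> (m ^ 2 <= 4 * n)%N -> (m <= k ^ c)%N ->
  n%:R `^ (2 * c)%:R^-1 <= k%:R :> R /\
  (m ^ 3)%:R <= 8%:R * n%:R `^ (3%:R / 2%:R) :> R.
Proof.
move=> c0 nm mn mk; split.
  have h : n%:R <= k%:R `^ (2 * c)%:R :> R.
    rewrite powR_mulrn ?ler0n // -natrX ler_nat; apply: leq_trans nm _.
    by rewrite mulnC expnM leq_sqr.
  have c2 : (2 * c)%:R != 0 :> R by rewrite pnatr_eq0 muln_eq0 /= -lt0n.
  have -> : k%:R = (k%:R `^ (2 * c)%:R) `^ (2 * c)%:R^-1 :> R.
    by rewrite -powRrM mulfV // powRr1 ?ler0n.
  by apply: ge0_ler_powR; rewrite ?nnegrE ?powR_ge0 ?invr_ge0 ?ler0n.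
have h : (m ^ 2)%:R <= 2%:R `^ 2%:R * n%:R :> R.
  by rewrite powR_mulrn ?ler0n // -natrX -natrM ler_nat.
have half (x : nat) : (x%:R `^ 2%:R) `^ (3%:R / 2%:R) = (x ^ 3)%:R :> R.
  rewrite -powRrM (_ : 2%:R * _ = 3%:R); last by rewrite mulrC divfK // pnatr_eq0.
  by rewrite powR_mulrn ?ler0n // natrX.
rewrite -half (_ : 8%:R = (2 ^ 3)%:R) // -(half 2%N) -powRM ?powR_ge0 ?ler0n //.
apply: ge0_ler_powR.
- by rewrite divr_ge0 ?ler0n.
- by rewrite nnegrE powR_ge0.
- by rewrite nnegrE mulr_ge0 ?powR_ge0 ?ler0n.
- by rewrite powR_mulrn ?ler0n // -natrX.
Qed.

Theorem theorem1p4 (R : realType) :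
  exists2 eps : R, 0 < eps &
  exists2 C : R, 0 < C &
  forall (p : nat) (s : nat) (P : {set 'rV['F_p]_2}) (alpha beta : 'F_p),
    prime p ->
    (#|P| < p)%N ->
    no_collinear s P ->
    alpha != 0 -> beta != 0 ->
    (#|Pi_dot alpha beta P|)%:R
      <= C * s%:R * ((#|P|)%:R `^ (3%:R / 2%:R - eps)).
Proof.
have [c c0 hc] := Pi_dot_nat_bound.
(* The saving is the factor [k], which is at least [n^(1 / (2 c))]. *)
exists (2 * c)%:R^-1; first by rewrite invr_gt0 ltr0n muln_gt0.
exists ((2 ^ c.+1)%:R * 8%:R); first by rewrite mulr_gt0 ?ltr0n ?expn_gt0.
move=> p s P alpha beta pr_p Pp hs alpha0 _.
have [P0|P0] := posnP #|P|.
  rewrite (_ : #|Pi_dot alpha beta P| = 0%N).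
    by rewrite !mulr_ge0 ?powR_ge0 ?ler0n.
  apply/eqP; rewrite cards_eq0 -subset0; apply/subsetP => t.
  by rewrite inE (cards0_eq P0) inE.
have [m [k [Pm mP mk kPi]]] := hc p s P alpha beta pr_p P0 Pp hs alpha0.
have [h1 h2] := powR_half_le R c0 Pm mP mk.
set N : R := #|P|%:R in h1 h2 *; set eps : R := (2 * c)%:R^-1 in h1 *.
have N0 : 0 < N by rewrite ltr0n.
have Ne : 0 < N `^ eps by apply: powR_gt0.
(* Multiplying by [N^eps] restores the exponent [3/2] on the right; on the left [N^eps] is bounded
   by [k]. *)
rewrite -(ler_pM2r Ne) -[X in _ <= X]mulrA -powRD; last by rewrite (gt_eqF N0) implybT.
rewrite subrK; apply: (@le_trans _ _ (#|Pi_dot alpha beta P|%:R * k%:R)).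
  by rewrite ler_wpM2l.
rewrite -natrM mulnC; apply: (@le_trans _ _ (2 ^ c.+1 * s * m ^ 3)%:R); first by rewrite ler_nat.
rewrite [X in _ <= X * _]mulrAC -[X in _ <= X]mulrA natrM (natrM _ _ s).
by rewrite ler_wpM2l // mulr_ge0.
Qed.
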